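(* Let $a\in L^\infty(\mathbb T^d;\mathbb R)$ with $a\ge a_{\min}>0$ a.e., let $f\in L^2(\mathbb T^d;\mathbb R)$ be mean-zero ($\hat f_{\mathbf 0}=0$), and let $u\in H$ be the unique mean-zero weak solution of $-\nabla\cdot(a\nabla u)=f$ on $\mathbb T^d$. Assume that $\operatorname{supp}(\hat a)$ and $\operatorname{supp}(\hat f)$ are finite and that $$3\|a-\hat a_{\mathbf 0}\|_{L^\infty}<a_{\min}.$$ Then for every $N\in\mathbb N_0$, with $\mathcal S^N:=\mathcal S^N[\hat a](\operatorname{supp}\hat f)$, $$\|u-u|_{\mathcal S^N}\|_H\le\left(\frac{\|a-\hat a_{\mathbf 0}\|_{L^\infty}}{a_{\min}-2\|a-\hat a_{\mathbf 0}\|_{L^\infty}}\right)^{N+1}\frac{\|f\|_{L^2}}{a_{\min}}.$$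
   Context: $\mathbb T=\mathbb R/\mathbb Z$; $e_{\mathbf k}(\mathbf x)=e^{2\pi i\mathbf k\cdot\mathbf x}$; $\hat g_{\mathbf k}=\int_{\mathbb T^d}g\,\overline{e_{\mathbf k}}\,d\mathbf x$. For $\mathcal D\subset\mathbb Z^d$, the frequency restriction is $u|_{\mathcal D}=\sum_{\mathbf k\in\mathcal D}\hat u_{\mathbf k}e_{\mathbf k}$. $H$ is the space of $u\in H^1(\mathbb T^d;\mathbb C)$ with $\hat u_{\mathbf 0}=0$, with norm $\|u\|_H^2=\int_{\mathbb T^d}|\nabla u|^2$. A weak solution satisfies $\int_{\mathbb T^d}a\nabla u\cdot\overline{\nabla v}=\langle f,v\rangle_{L^2}$ for all $v\in H^1$. In $a-\hat a_{\mathbf 0}$ the number $\hat a_{\mathbf 0}$ is a constant function. Stamping sets: for $F\subset\mathbb Z^d$, $\mathcal S^0[\hat a](F)=F$ and $\mathcal S^N[\hat a](F)=\mathcal S^{N-1}[\hat a](F)+\operatorname{supp}(\hat a)$ (Minkowski sum) for $N\ge1$. *)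

(* Defs.v *)
From HB Require Import structures.
From mathcomp Require Import all_boot all_order all_algebra.
From mathcomp Require Import all_classical all_reals all_analysis.
From mathcomp Require Import complex.

Set Implicit Arguments.
Unset Strict Implicit.
Unset Printing Implicit Defensive.

Import Order.TTheory GRing.Theory Num.Theory.
Import numFieldNormedType.Exports.

Local Open Scope classical_set_scope.
Local Open Scope ring_scope.
Local Open Scope complex_scope.

(** The product sigma-algebra on T^n (for T = R, the Borel sets of R^n). *)

Section measurable_rV.
Context {d} {T : sigmaRingType d}.
Variable n : nat.

Let coord (i : 'I_n) (x : 'rV[T]_n) : T := x ord0 i.

Let rV_set0 : g_sigma_preimage coord set0.
Proof. exact: sigma_algebra0. Qed.

Let rV_setC A : g_sigma_preimage coord A -> g_sigma_preimage coord (~` A).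
Proof. exact: sigma_algebraC. Qed.

Let rV_bigcup (F : _^nat) : (forall i, g_sigma_preimage coord (F i)) ->
  g_sigma_preimage coord (\bigcup_i (F i)).
Proof. exact: sigma_algebra_bigcup. Qed.

HB.instance Definition _ := @isMeasurable.Build (measure_tuple_display d)
  'rV[T]_n (g_sigma_preimage coord) rV_set0 rV_setC rV_bigcup.

End measurable_rV.

Lemma measurable_coord d (T : sigmaRingType d) n (i : 'I_n) :
  measurable_fun [set: 'rV[T]_n] (fun x : 'rV[T]_n => x ord0 i).
Proof.
move=> _ Y mY; rewrite setTI; apply: sub_sigma_algebra => /=.
rewrite -bigcup_seq/=; exists i => /=; first by rewrite mem_index_enum.
by exists Y => //; rewrite setTI.
Qed.

Lemma measurable_fun_rVP d1 d2 (T1 : measurableType d1) (T2 : measurableType d2)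
    n (f : T1 -> 'rV[T2]_n) :
  (forall i, measurable_fun [set: T1] (fun x => f x ord0 i)) ->
  measurable_fun [set: T1] f.
Proof.
move=> mf.
pose c i (x : 'rV[T2]_n) := x ord0 i.
have : <<s \big[setU/set0]_(i < n) preimage_set_system setT (c i) measurable >>
       `<=` [set A | measurable (f @^-1` A)].
  apply: smallest_sub.
    split => /=.
    - by rewrite preimage_set0.
    - by move=> A mA; rewrite setTD -preimage_setC; exact: measurableC.
    - by move=> F mF; rewrite preimage_bigcup; exact: bigcup_measurable.
  rewrite -bigcup_seq => A [i _ [B mB <-]] /=; rewrite setTI.
  by have := mf i measurableT B mB; rewrite setTI.
by move=> K _ A mA; rewrite setTI; exact: K.
Qed.

(** Lebesgue measure on T^n = (R/Z)^n, transported to the fundamental domain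
    [0, 1)^n of R^n: the n-fold product of Lebesgue measure on [0, 1). *)

Section unit_measure.
Variable R : realType.

Definition unit_measure : set (measurableTypeR R) -> \bar R :=
  mrestr lebesgue_measure (measurable_itv `[0%R, 1%R[).

HB.instance Definition _ := Measure.on unit_measure.

Let unit_measureT : unit_measure setT = 1%E.
Proof.
by rewrite /unit_measure /mrestr setTI lebesgue_measure_itv/= lte01 oppr0 adde0.
Qed.

HB.instance Definition _ :=
  Measure_isProbability.Build _ _ _ unit_measure unit_measureT.

End unit_measure.
Arguments unit_measure {R}.

Section torus_measure.
Variable R : realType.

Definition consrV n (p : measurableTypeR R * 'rV[R]_n) : 'rV[R]_n.+1 :=
  row_mx (const_mx p.1 : 'rV[R]_1) p.2.

Lemma consrV0 n p : @consrV n p ord0 ord0 = p.1.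
Proof.
rewrite /consrV (_ : ord0 = lshift n (ord0 : 'I_1)); last exact: val_inj.
by rewrite (@row_mxEl _ _ 1 n) mxE.
Qed.

Lemma consrVS n p (i : 'I_n) : @consrV n p ord0 (lift ord0 i) = p.2 ord0 i.
Proof.
rewrite /consrV (_ : lift _ _ = rshift 1 i :> 'I_(1 + n)); last exact: val_inj.
by rewrite (@row_mxEr _ _ 1 n).
Qed.

Lemma measurable_consrV n :
  measurable_fun [set: measurableTypeR R * 'rV[R]_n] (@consrV n).
Proof.
apply: measurable_fun_rVP => i; case: (unliftP ord0 i) => [j|] ->.
  apply: (eq_measurable_fun ((fun x : 'rV[R]_n => x ord0 j) \o snd)).
    by move=> p _; rewrite consrVS.
  exact: (measurableT_comp (measurable_coord j) measurable_snd).
apply: (eq_measurable_fun fst); last exact: measurable_fst.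
by move=> p _; rewrite consrV0.
Qed.

HB.instance Definition _ n :=
  isMeasurableFun.Build _ _ _ _ (@consrV n) (@measurable_consrV n).

Section unit_prod.
Variables (n : nat) (P : probability 'rV[R]_n R).

Definition unit_prod : set (measurableTypeR R * 'rV[R]_n) -> \bar R :=
  (unit_measure \x P)%E.

HB.instance Definition _ := Measure.on unit_prod.

Let unit_prodT : unit_prod setT = 1%E.
Proof.
rewrite /unit_prod -setXTT product_measure1E//.
by rewrite -[RHS]mule1; congr (_ * _)%E; exact: probability_setT.
Qed.

HB.instance Definition _ :=
  Measure_isProbability.Build _ _ _ unit_prod unit_prodT.

End unit_prod.

Fixpoint torus_measure n : probability 'rV[R]_n R :=
  if n is m.+1 then distribution (unit_prod (torus_measure m)) (@consrV m)
  else \d_(0 : 'rV[R]_0).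

Lemma torus_measure_box n (A : 'I_n -> set R) :
  (forall i, measurable (A i)) ->
  torus_measure n [set x | forall i, A i (x ord0 i)] =
  (\prod_(i < n) unit_measure (A i))%E.
Proof.
elim: n A => [|n IH] A mA.
  rewrite big_ord0 /= /dirac indicE mem_set//.
  by case.
rewrite big_ord_recl -IH// /= /distribution /pushforward /=.
have mB : measurable [set x : 'rV[R]_n | forall i, A (lift ord0 i) (x ord0 i)].
  rewrite (_ : [set _ | _] = \bigcap_i
      ((fun x : 'rV[R]_n => x ord0 i) @^-1` A (lift ord0 i))); last first.
    by apply/seteqP; split => [x xA i _|x xA i]; [exact: xA|exact: xA].
  apply: fin_bigcap_measurable => // i _.
  rewrite -[X in measurable X]setTI.
  exact: (measurable_coord i measurableT (mA (lift ord0 i))).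
transitivity (unit_prod (torus_measure n) (A ord0 `*`
    [set x : 'rV[R]_n | forall i, A (lift ord0 i) (x ord0 i)])); last first.
  by apply: product_measure1E; [exact: mA|exact: mB].
congr (unit_prod _ _).
apply/seteqP; split => [[x y] /= H|[x y] /= [Hx Hy] i].
  split => [|i]; first by have := H ord0; rewrite consrV0.
  by have := H (lift ord0 i); rewrite consrVS.
by case: (unliftP ord0 i) => [j|] ->; rewrite ?consrV0 ?consrVS.
Qed.

End torus_measure.

Section torus_functions.
Variables (R : realType) (d : nat).
Local Notation C := (complex R).
Local Notation vec := 'rV[R]_d.
Local Notation freq := 'rV[int]_d.
Local Notation mu := (torus_measure R d).

(** Functions on T^d are Z^d-periodic functions on R^d. *)
Definition periodic (V : Type) (g : vec -> V) :=
  forall (x : vec) (k : freq), g (x + map_mx intr k) = g x.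

Definition cmeasurable (g : vec -> C) :=
  measurable_fun setT (fun x => complex.Re (g x)) /\
  measurable_fun setT (fun x => complex.Im (g x)).

Definition cintegral (g : vec -> C) : C :=
  (\int[mu]_x complex.Re (g x)) +i* (\int[mu]_x complex.Im (g x)).

Definition to_complex (g : vec -> R) : vec -> C := fun x => (g x)%:C.

Definition modulus (z : C) : R := ComplexField.Normc.normc z.

Definition eLpnorm (p : \bar R) (g : vec -> C) : \bar R :=
  'N[mu]_p[(fun x => (modulus (g x))%:E)]%E.

(** Elements of L^p(T^d; C) are represented by (Borel) functions; all notions
    below are invariant under almost everywhere equality. *)
Definition inLp (p : \bar R) (g : vec -> C) :=
  [/\ periodic g, cmeasurable g & (eLpnorm p g < +oo)%E].

(** Meant for [inLp p g]: [fine] sends +oo to 0. *)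
Definition Lpnorm (p : \bar R) (g : vec -> C) : R := fine (eLpnorm p g).

(** [echar k x] is exp (2 i pi k.x). *)
Definition echar (k : freq) (x : vec) : C :=
  let t := 2 * pi * \sum_(j < d) (k ord0 j)%:~R * x ord0 j in
  cos t +i* sin t.

Definition fcoef (g : vec -> C) (k : freq) : C :=
  cintegral (fun x => g x * (echar k x)^*).

Definition fsupp (g : vec -> C) : set freq := [set k | fcoef g k != 0].

(** Meant for finite [D]: the L^2 series is then this finite sum. *)
Definition freq_restrict (D : set freq) (g : vec -> C) : vec -> C :=
  fun x => \sum_(k \in D) (fcoef g k * echar k x).

Definition partial (j : 'I_d) (phi : vec -> R) : vec -> R :=
  fun x => 'D_(delta_mx ord0 j) phi x.

Fixpoint Cn (n : nat) (phi : vec -> R) : Prop :=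
  continuous phi /\
  if n is m.+1 then
    forall j, (forall x, derivable phi x (delta_mx ord0 j)) /\
              Cn m (partial j phi)
  else True.

Definition test_function (phi : vec -> R) :=
  periodic phi /\ forall n, Cn n phi.

(** By linearity, testing against real functions is the same as testing against
    complex ones. *)
Definition is_weak_partial (j : 'I_d) (g h : vec -> C) :=
  inLp 2%:E h /\
  forall phi, test_function phi ->
    cintegral (fun x => g x * (partial j phi x)%:C) =
    - cintegral (fun x => h x * (phi x)%:C).

Definition inH1 (g : vec -> C) :=
  inLp 2%:E g /\ forall j, exists h, is_weak_partial j g h.

(** A representative of the weak j-th partial derivative, which is unique up to
    almost everywhere equality when it exists (and 0 when it does not). *)
Definition wpartial (j : 'I_d) (g : vec -> C) : vec -> C :=
  xget (cst 0) [set h | is_weak_partial j g h].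

Definition inH (g : vec -> C) := inH1 g /\ fcoef g 0 = 0.

Definition Hnorm (g : vec -> C) : R :=
  Num.sqrt (\int[mu]_x \sum_(j < d) modulus (wpartial j g x) ^+ 2).

Definition weak_solution (a f : vec -> R) (u : vec -> C) :=
  forall v, inH1 v ->
    cintegral (fun x =>
      (a x)%:C * \sum_(j < d) wpartial j u x * (wpartial j v x)^*) =
    cintegral (fun x => (f x)%:C * (v x)^*).

Fixpoint stamp (g : vec -> C) (F : set freq) (N : nat) : set freq :=
  if N is M.+1 then [set k + l | k in stamp g F M & l in fsupp g] else F.

End torus_functions.

(* Main.v *)
(** Writing [abar] for the mean of [a], [r_D] for [u - u|_D], the argument is an
    energy estimate along the stamping sets.  If [D'] and [D' + supp a] lie in
    [D] and [supp f] lies in [D], the gradient of [r_D] has no frequency in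
    [D], so testing the equation with [r_D] gives
    [int a grad r_D' . conj (grad r_D) = 0], while replacing [a] by [abar]
    gives [abar |r_D|^2].  Subtracting,
    [abar |r_D|^2 <= delta |r_D'| |r_D|], hence [|r_D| <= (delta / abar) |r_D'|],
    and [amin - 2 delta <= amin <= abar].  The start [|u| <= |f| / amin] comes
    from testing with [u] and Bessel's inequality, as [f] has finitely many
    frequencies.

    That [a] and [f] are trigonometric polynomials needs the uniqueness theorem
    for Fourier coefficients: the [g phi] whose coefficients all vanish are
    stable under multiplication of [phi] by [y = alpha + beta cos (2 pi (x_j - c))],
    hence, by dominated convergence along [(1 - y^n)^(n 2^n)], by the indicator of
    [y < 1/2]; so [g] integrates to 0 over a pi-system generating the Borel sets. *)

Require Import Defs.
From mathcomp Require Import all_boot all_order all_algebra.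
From mathcomp Require Import all_classical all_reals all_analysis.
From mathcomp Require Import complex measurable_realfun ess_sup_inf ring lra.

Set Implicit Arguments.
Unset Strict Implicit.
Unset Printing Implicit Defensive.

Import Order.TTheory GRing.Theory Num.Theory.
Import numFieldNormedType.Exports.

Local Open Scope classical_set_scope.
Local Open Scope ring_scope.

(** * Measure and integration on the torus *)

(** Weak derivatives are chosen by [xget], so the gradient of a residual and the difference of the
    gradients are a priori unrelated representatives. Fourier coefficients reconcile them: cosines
    and sines are test functions, so each weak derivative has the coefficients 2 pi i k_j g_k, and
    the uniqueness theorem turns equal coefficients into almost everywhere equality. That theorem
    thus serves the derivatives as much as [a] and [f]. Its proof reaches indicators by bounded
    multipliers, which asks of g only that it be integrable.

    The energy estimate needs the stamping sets to increase. They do because 0 lies in supp a, the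
    mean of [a] being at least amin > 0. The exponent N + 1 counts one stage more than the
    stampings: the empty set, whose residual is u itself, precedes supp f.

    Norms are compared through their squares. Cauchy-Schwarz is replaced by a weighted pointwise
    inequality, half of whose right-hand side is absorbed; the only square root is taken at the very
    end. The start also hides a Poincare inequality with constant 1, read off frequency by
    frequency, for which u must have mean zero. *)

Lemma rV_box_cover (R : realType) n (A : set 'rV[R]_n) :
  open A -> A = \bigcup_(p in [set p : 'rV[rat]_n * nat |
     [set y : 'rV[R]_n | forall i, `|ratr (p.1 ord0 i) - y ord0 i| < p.2.+1%:R^-1] `<=` A])
   [set y : 'rV[R]_n | forall i, `|ratr (p.1 ord0 i) - y ord0 i| < p.2.+1%:R^-1].
Proof.
move=> oA; apply/seteqP; split => [x Ax|x [p pA xp]]; last exact: pA.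
have /nbhs_ballP[e /= e0 eA] : nbhs x A by exact: open_nbhs_nbhs.
have e20 : 0 < e / 2 by rewrite divr_gt0.
have [m me] : exists m : nat, m.+1%:R^-1 < e / 2.
  have [m _ /(_ _ (leqnn m))] := near_infty_natSinv_lt (PosNum e20).
  by exists m.
have c0 : 0 < m.+1%:R^-1 :> R by rewrite invr_gt0.
pose c : R := m.+1%:R^-1; rewrite -/c in me c0.
have /choice[q qP] : forall i, exists q : rat, `|ratr q - x ord0 i| < c.
  move=> i; have : x ord0 i - c < x ord0 i + c by lra.
  move=> /rat_in_itvoo[q]; rewrite in_itv/= => /andP[q1 q2].
  by exists q; rewrite ltr_norml; apply/andP; split; lra.
exists (\row_i q i, m).
  move=> y /= ym; apply: eA; rewrite -ball_normE /= /ball_ /=.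
  rewrite [X in X < _]/Num.norm/= mx_normrE; apply: bigmax_lt => //= -[i j] _ /=.
  rewrite !mxE ord1; move: (ym j) (qP j); rewrite mxE -/c => h1 h2.
  rewrite (_ : x ord0 j - y ord0 j = (ratr (q j) - y ord0 j) - (ratr (q j) - x ord0 j)); last by ring.
  by rewrite (le_lt_trans (ler_normB _ _))//; lra.
by move=> i /=; rewrite mxE.
Qed.

Lemma ae_le_integrable d (T : measurableType d) (R : realType)
    (mu : {measure set T -> \bar R}) (f g : T -> R) :
  measurable_fun setT f -> {ae mu, forall x, `|f x| <= g x} ->
  mu.-integrable setT (EFin \o g) -> mu.-integrable setT (EFin \o f).
Proof.
move=> mf fg /integrableP[mg goo]; apply/integrableP; split; first exact/measurable_EFinP.
apply: le_lt_trans goo; apply: ae_ge0_le_integral => //.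
- exact/measurableT_comp/measurable_EFinP.
- exact/measurableT_comp.
- apply: filterS fg => x fgx _ /=.
  by rewrite lee_fin (le_trans fgx)// ler_norm.
Qed.

Lemma ae_bounded_integrable d (T : measurableType d) (R : realType)
    (mu : probability T R) (f : T -> R) (M : R) :
  measurable_fun setT f -> {ae mu, forall x, `|f x| <= M} ->
  mu.-integrable setT (EFin \o f).
Proof.
move=> mf fM; apply: (ae_le_integrable mf fM); exact: finite_measure_integrable_cst.
Qed.

Lemma measurable_rV_box (R : realType) n (A : 'I_n -> set R) :
  (forall i, measurable (A i)) -> measurable [set x : 'rV[R]_n | forall i, A i (x ord0 i)].
Proof.
move=> mA; rewrite (_ : mkset _ = \bigcap_i ((fun x : 'rV[R]_n => x ord0 i) @^-1` A i)); last first.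
  by apply/seteqP; split => x /= xA i; [move=> _|]; exact: xA.
apply: fin_bigcap_measurable => // i _; rewrite -[X in measurable X]setTI.
exact: measurable_coord.
Qed.

(** Open sets come from the sup norm, measurable sets from the coordinates; the boxes with rational
    centre and radius 1/(m+1) belong to both worlds and are countably many. *)
Lemma measurable_open_rV (R : realType) n (A : set 'rV[R]_n) :
  open A -> measurable A.
Proof.
move=> /rV_box_cover ->; rewrite bigcup_mkcond.
apply: countable_bigcupT_measurable; first exact: countableP.
move=> p; case: ifPn => // _.
apply: (@measurable_rV_box _ _ (fun i => [set z | `|ratr (p.1 ord0 i) - z| < p.2.+1%:R^-1])) => i.
apply: open_measurable.
rewrite (_ : [set z | _] = ball (ratr (p.1 ord0 i) : R) p.2.+1%:R^-1); first exact: ball_open.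
by rewrite -ball_normE.
Qed.

Lemma continuous_measurable_rV (R : realType) n (f : 'rV[R]_n -> R) :
  continuous f -> measurable_fun setT f.
Proof.
move=> cf; apply: (measurability _ (RGenOpens.measurableE R)) => _ [_ [a [b ->] <-]].
rewrite setTI; apply: measurable_open_rV.
by move/continuousP : cf; apply; exact: itv_open.
Qed.

Section torus.
Context {R : realType} {n : nat}.
Local Notation mu := (torus_measure R n).
Implicit Types f g : 'rV[R]_n -> R.

Lemma ae_unit_open_cube : {ae mu, forall x : 'rV[R]_n, forall i, 0 < x ord0 i < 1}.
Proof.
have mI : measurable (`]0%R, 1%R[ : set R) by exact: measurable_itv.
pose A := [set x : 'rV[R]_n | forall i, `]0%R, 1%R[%classic (x ord0 i)].
have mA : measurable A by exact: (@measurable_rV_box R n (fun=> `]0%R, 1%R[%classic)).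
have A1 : mu A = 1%E.
  rewrite [LHS](@torus_measure_box R n (fun=> `]0%R, 1%R[%classic))//; apply: big1 => i _.
  rewrite /unit_measure /mrestr setIidl; last first.
    by move=> z /=; rewrite !in_itv/= => /andP[/ltW -> ->].
  by rewrite lebesgue_measure_itv/= lte01 oppr0 adde0.
exists (~` A); split.
- exact: measurableC.
- by rewrite [LHS]probability_setC// A1 subee.
- move=> x /= nx xA; apply: nx => i; have := xA i.
  by rewrite /= in_itv.
Qed.

Lemma ae_unit_cube : {ae mu, forall x : 'rV[R]_n, forall i, 0 <= x ord0 i < 1}.
Proof.
apply: filterS ae_unit_open_cube => x x01 i.
by have /andP[/ltW -> ->] := x01 i.
Qed.

Lemma continuous_bounded_cube f : continuous f ->
  exists M, forall x : 'rV[R]_n, (forall i, 0 <= x ord0 i < 1) -> `|f x| <= M.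
Proof.
move=> cf.
have cK : compact [set v : 'rV[R]_n | forall i, `[0, 1]%classic (v ord0 i)].
  exact (@rV_compact R n (fun=> `[0, 1]%classic) (fun=> @segment_compact R 0 1)).
have := continuous_compact (continuous_subspaceT cf) cK.
move=> /compact_bounded[M [_ MB]].
exists (M + 1) => x xI; apply: (MB (M + 1)); first by rewrite ltrDl.
exists x => // i; have /andP[x0 x1] := xI i.
by rewrite /= in_itv /= x0 ltW.
Qed.

End torus.

(** * Integrals of derivatives of periodic functions *)

Lemma eq_derive_line (R : realType) (V W : normedModType R) (f : V -> R) (g : W -> R)
    v w x y : (forall h : R, f (h *: v + x) = g (h *: w + y)) ->
  (derivable f x v -> derivable g y w) /\ 'D_w g y = 'D_v f x.
Proof.
move=> fg; have fg0 : f x = g y by have := fg 0; rewrite !scale0r !add0r.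
have E : (fun h : R => h^-1 *: (f (h *: v + x) - f x)) =
         (fun h : R => h^-1 *: (g (h *: w + y) - g y)).
  by apply/funext => h; rewrite fg fg0.
by split; rewrite /derivable /derive /= E.
Qed.

(** [unit_measure] lives on [0, 1) and the fundamental theorem of calculus on [0, 1]; the two differ
    by a null point. *)
Lemma integral_unit_measure (R : realType) (f : R -> R) : continuous f ->
  (\int[unit_measure]_x (f x)%:E = \int[lebesgue_measure]_(x in `[0%R, 1%R]) (f x)%:E)%E.
Proof.
move=> cf; have mf := continuous_measurable_fun cf.
pose D := `[0%R, 1%R[%classic : set R.
have mD : measurable D by exact: measurable_itv.
have mfD A : measurable_fun A (EFin \o f) by exact/measurable_funTS/measurable_EFinP.
have unitDC : unit_measure (~` D) = 0%E.
  by rewrite /unit_measure /mrestr setICl measure0.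
have unitD (A : set (measurableTypeR R)) : A `<=` D -> unit_measure A = lebesgue_measure A.
  by move=> AD; rewrite /unit_measure /mrestr; congr (lebesgue_measure _); exact/setIidPl.
transitivity (\int[unit_measure]_x ((EFin \o f) \_ D) x)%E.
  apply: ae_eq_integral => //.
  - exact: mfD.
  - by apply/(measurable_restrictT (EFin \o f)) => //; exact: mfD.
  exists (~` D); split => //; first exact: measurableC.
  by move=> x /= nx xD; apply: nx => _; rewrite patchE mem_set.
rewrite -integral_mkcond (@eq_measure_integral _ _ _ _ lebesgue_measure); last first.
  by move=> A _ AD; exact: unitD.
by rewrite integral_itv_bndo_bndc.
Qed.

Lemma integral_deriv_periodic (R : realType) (F : R -> R) :
  (forall x, derivable F x 1) -> continuous (derive1 F) -> F 1 = F 0 ->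
  (\int[unit_measure]_x ((derive1 F) x)%:E = 0)%E.
Proof.
move=> dF cF F10; rewrite integral_unit_measure//.
have cF' : continuous F by move=> x; apply/differentiable_continuous/derivable1_diffP/dF.
rewrite (@continuous_FTC2 R (derive1 F) F 0 1 ltr01); first by rewrite F10 subee.
- exact: continuous_subspaceT.
- split; first by move=> x _; exact: dF.
  + exact/cvg_at_right_filter/cF'.
  + exact/cvg_at_left_filter/cF'.
- by [].
Qed.

Lemma consrV_line0 (R : realType) n (t : R) (y : 'rV[R]_n) :
  consrV (t, y) = t *: delta_mx ord0 ord0 + consrV (0, y).
Proof.
apply/rowP => i; case: (unliftP ord0 i) => [k|] ->.
  by rewrite consrVS [RHS]mxE consrVS 2!mxE eqxx/= mulr0 add0r.
by rewrite consrV0 [RHS]mxE consrV0 2!mxE !eqxx mulr1 addr0.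
Qed.

Lemma consrV_lineS (R : realType) n (t h : R) (v y : 'rV[R]_n) :
  consrV (t, h *: v + y) = h *: consrV (0, v) + consrV (t, y).
Proof.
apply/rowP => i; case: (unliftP ord0 i) => [k|] ->.
  by rewrite consrVS [RHS]mxE [X in _ = X + _]mxE !consrVS !mxE.
by rewrite consrV0 [RHS]mxE [X in _ = X + _]mxE !consrV0 mulr0 add0r.
Qed.

Lemma consrV_delta (R : realType) n (j : 'I_n) :
  consrV (0, delta_mx ord0 j) = delta_mx ord0 (lift ord0 j) :> 'rV[R]_n.+1.
Proof.
apply/rowP => i; case: (unliftP ord0 i) => [k|] ->.
  by rewrite consrVS !mxE (inj_eq lift_inj).
by rewrite consrV0 mxE (negbTE (neq_lift _ _)) andbF.
Qed.

Lemma continuous_consrV1 (R : realType) n (y : 'rV[R]_n) :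
  continuous (fun t : R => consrV (t, y)).
Proof.
move=> t; under eq_fun do rewrite consrV_line0.
rewrite consrV_line0; apply: cvgD; last exact: cvg_cst.
by apply: cvgZr_tmp; exact: cvg_id.
Qed.

Lemma continuous_consrV2 (R : realType) n (t : R) :
  continuous (fun y : 'rV[R]_n => consrV (t, y)).
Proof.
move=> y s /= /(nbhs_ballP _)[e e0 es].
apply/nbhs_ballP; exists e => //= z [_ yz]; apply: es; split => // i' i.
rewrite ord1; case: (unliftP ord0 i) => [k|] ->; first by rewrite !consrVS; exact: yz.
by rewrite !consrV0; exact: ballxx.
Qed.

(** Induction on the dimension, with Fubini on the product that defines [torus_measure]. The order
    of integration is chosen so that the inner integral vanishes: for a later coordinate it runs
    over a slice and is 0 by induction, for coordinate 0 it is one-dimensional and equals F(1) -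
    F(0). By [eq_derive_line], a directional derivative depends only on the function along a line,
    hence passes to slices. *)
Lemma integral_partial_periodic (R : realType) n (j : 'I_n) (f : 'rV[R]_n -> R) :
  continuous f -> Defs.periodic f ->
  (forall x, derivable f x (delta_mx ord0 j)) -> continuous (partial j f) ->
  (\int[torus_measure R n]_x (partial j f x)%:E = 0)%E.
Proof.
elim: n j f => [[]//|n IH] j f cf pf df cdf.
have mdf := continuous_measurable_rV cdf.
have mdf' := measurableT_comp mdf (@measurable_consrV R n).
have [M fM] := continuous_bounded_cube cdf.
pose P := unit_prod (torus_measure R n).
have intf : P.-integrable setT (EFin \o partial j f \o @consrV R n).
  apply: (@ae_bounded_integrable _ _ _ _ _ M) => //.
  (* The bound M holds on the cube only. The exceptional set is pulled back along [consrV], and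
     stays null because [torus_measure] is the image of [P]. *)
  have [N [mN N0 NM]] := @ae_unit_cube R n.+1.
  exists (@consrV R n @^-1` N); split.
  - by rewrite -[X in measurable X]setTI; exact: measurable_consrV.
  - exact: N0.
  - by move=> p /= pM; apply: NM => /= p01; apply: pM; exact: fM.
rewrite [LHS](@integral_distribution _ _ _ _ _ P) //; last exact/measurable_EFinP.
case: (unliftP ord0 j) => [k jk|j0].
- rewrite -integral12_prod_meas1//=; apply: integral0_eq => t _ /=.
  rewrite /fubini_F /=.
  have ft h y : f (h *: delta_mx ord0 j + consrV (t, y)) =
      f (consrV (t, h *: delta_mx ord0 k + y)).
    by rewrite consrV_lineS consrV_delta jk.
  have ftD y := @eq_derive_line R _ _ f (fun y => f (consrV (t, y))) _ _ _ y (ft^~ y).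
  have fE y : partial j f (consrV (t, y)) = partial k (fun y => f (consrV (t, y))) y.
    by rewrite /partial; have [_ <-] := ftD y.
  under eq_integral do rewrite fE.
  apply: IH.
  + move=> y; apply: continuous_comp; [exact: continuous_consrV2|exact: cf].
  (* The period z of the slice is the period (0, z) of f. *)
  + move=> y z; rewrite -(pf (consrV (t, y)) (row_mx (0 : 'rV[int]_1) z : 'rV[int]_n.+1)); congr (f _).
    apply/rowP => i; case: (unliftP ord0 i) => [l|] ->.
      rewrite consrVS [RHS]mxE consrVS [LHS]mxE; congr (_ + _).
      rewrite [LHS]mxE [RHS]mxE; congr (_%:~R).
      rewrite (_ : lift _ _ = rshift 1 l :> 'I_(1 + n)); last exact: val_inj.
      by rewrite (@row_mxEr _ _ 1 n).
    rewrite consrV0 [RHS]mxE consrV0 [X in _ = _ + X]mxE.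
    rewrite (_ : ord0 = lshift n (ord0 : 'I_1)); last exact: val_inj.
    by rewrite (@row_mxEl _ _ 1 n) mxE addr0.
  + by move=> y; have [+ _] := ftD y; apply; exact: df.
  + rewrite (_ : partial k _ = (fun y => partial j f (consrV (t, y)))).
      by move=> y; apply: continuous_comp; [exact: continuous_consrV2|exact: cdf].
    by apply/funext => y; rewrite fE.
- rewrite -integral21_prod_meas1//=; apply: integral0_eq => y _ /=.
  rewrite /fubini_G /=.
  have ft h t : f (h *: delta_mx ord0 j + consrV (t, y)) = f (consrV (h *: 1 + t, y)).
    rewrite j0 [in LHS]consrV_line0 addrA -scalerDl [in RHS]consrV_line0.
    by rewrite [h *: 1]mulr1.
  have ftD t := @eq_derive_line R _ R^o f (fun t => f (consrV (t, y))) _ _ _ t (ft^~ t).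
  have fE t : partial j f (consrV (t, y)) = derive1 (fun t => f (consrV (t, y))) t.
    by rewrite /partial derive1E; have [_ <-] := ftD t.
  under eq_integral do rewrite fE.
  apply: integral_deriv_periodic.
  + by move=> t; have [+ _] := ftD t; apply; exact: df.
  + rewrite (_ : derive1 _ = (fun t => partial j f (consrV (t, y)))).
      by move=> t; apply: continuous_comp; [exact: continuous_consrV1|exact: cdf].
    by apply/funext => t; rewrite fE.
  + rewrite -(pf (consrV (0, y)) (delta_mx ord0 ord0)); congr (f _).
    rewrite consrV_line0 scale1r addrC; congr (_ + _).
    by apply/rowP => i; rewrite !mxE; case: (_ && _).
Qed.

(** * Trigonometric functions as test functions *)

Section phase.
Context {R : realType} {d : nat}.
Implicit Types (k l : 'rV[int]_d) (x : 'rV[R]_d).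
Local Notation e_ j := (delta_mx ord0 j).

Definition phase k x : R := 2 * pi * \sum_(j < d) (k ord0 j)%:~R * x ord0 j.

Lemma phaseD k l x : phase (k + l) x = phase k x + phase l x.
Proof.
rewrite /phase -mulrDr -big_split/=; congr (_ * _); apply: eq_bigr => j _.
by rewrite mxE intrD mulrDl.
Qed.

Lemma phaseN k x : phase (- k) x = - phase k x.
Proof.
rewrite /phase -mulrN -sumrN; congr (_ * _); apply: eq_bigr => j _.
by rewrite mxE intrN mulNr.
Qed.

Lemma phaseB k l x : phase (k - l) x = phase k x - phase l x.
Proof. by rewrite phaseD phaseN. Qed.

Lemma phase0 x : phase 0 x = 0.
Proof. by rewrite /phase big1 ?mulr0// => j _; rewrite mxE mul0r. Qed.

Lemma phase_delta j x : phase (e_ j) x = 2 * pi * x ord0 j.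
Proof.
rewrite /phase (bigD1 j)//= mxE !eqxx mul1r big1 ?addr0// => i ij.
by rewrite mxE (negbTE ij) andbF mul0r.
Qed.

Lemma phase_line k j x (h : R) :
  phase k (h *: e_ j + x) = h * (2 * pi * (k ord0 j)%:~R) + phase k x.
Proof.
rewrite /phase -[X in _ = X + _](_ : 2 * pi * (\sum_(i < d) (k ord0 i)%:~R * (h * (i == j)%:R)) = _).
  rewrite -mulrDr -big_split/=; congr (_ * _); apply: eq_bigr => i _.
  by rewrite !mxE eqxx mulrDr.
rewrite (bigD1 j)//= eqxx mulr1 big1 ?addr0; first by ring.
by move=> i /negbTE ->; rewrite !mulr0.
Qed.

Lemma continuous_phase k : continuous (phase k).
Proof.
have cS (r : seq 'I_d) :
    continuous (fun x : 'rV[R]_d => \sum_(j <- r) (k ord0 j)%:~R * x ord0 j).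
  elim: r => [|j r IH].
    rewrite (_ : (fun _ => _) = cst 0); first exact: cst_continuous.
    by apply/funext => x; rewrite big_nil.
  rewrite (_ : (fun _ => _) = ( *%R (k ord0 j)%:~R \o (fun x : 'rV[R]_d => x ord0 j)) \+
      (fun x : 'rV[R]_d => \sum_(j <- r) (k ord0 j)%:~R * x ord0 j)); last first.
    by apply/funext => x; rewrite big_cons.
  move=> x; apply: continuousD; last exact: IH.
  by apply: continuous_comp; [exact: coord_continuous|exact: mulrl_continuous].
move=> x; apply: (@continuous_comp _ _ _ _ ( *%R (2 * pi))); first exact: cS.
exact: mulrl_continuous.
Qed.

(** Along a coordinate line the phase is affine with slope 2 pi k_j, so the one-variable chain rule
    suffices. *)
Lemma is_derive_phase (G : R -> R) (a : R) k j x :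
  is_derive (phase k x) 1 G a ->
  is_derive x (e_ j) (G \o phase k) (a * (2 * pi * (k ord0 j)%:~R)).
Proof.
move=> Ga; set c := 2 * pi * (k ord0 j)%:~R.
have Lc : is_derive (0 : R) 1 (fun s : R => s * c + phase k x) c.
  rewrite -[X in is_derive _ _ _ X]addr0.
  apply: is_deriveD.
  rewrite (_ : (fun s : R => s * c) = c \*: id); last by apply/funext => s; rewrite /= mulrC.
  rewrite -[X in is_derive _ _ _ X]mulr1; exact: is_deriveZ.
have Ga' : is_derive ((fun s : R => s * c + phase k x) 0) 1 G a.
  by rewrite mul0r add0r.
have [dF DF] := @is_derive1_comp _ G (fun s : R => s * c + phase k x) 0 a c Ga' Lc.
have fg (h : R) : (G \o (fun s : R => s * c + phase k x)) (h *: 1 + 0) =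
    (G \o phase k) (h *: e_ j + x).
  by rewrite /= phase_line -/c addr0 [h *: 1]mulr1.
have [dG DG] := @eq_derive_line R R^o _ _ _ _ _ _ _ fg.
split; first exact: dG.
by rewrite DG.
Qed.

Lemma phase_periodic k x (z : 'rV[int]_d) : exists m : int,
  phase k (x + map_mx intr z) = phase k x + pi *+ 2 *~ m.
Proof.
exists (\sum_(j < d) k ord0 j * z ord0 j).
rewrite /phase -mulrzr rmorph_sum /= -[pi *+ 2]mulr_natl -mulrDr -big_split/=; congr (_ * _).
by apply: eq_bigr => j _; rewrite !mxE mulrDr intrM.
Qed.

Lemma cos_periodicz (t : R) (m : int) : cos (t + pi *+ 2 *~ m) = cos t.
Proof.
case: m => n; first exact: (periodicn (@cosD2pi R)).
by rewrite NegzE mulrNz -pmulrn -[LHS](periodicn (@cosD2pi R) n.+1) subrK.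
Qed.

Lemma sin_periodicz (t : R) (m : int) : sin (t + pi *+ 2 *~ m) = sin t.
Proof.
case: m => n; first exact: (periodicn (@sinD2pi R)).
by rewrite NegzE mulrNz -pmulrn -[LHS](periodicn (@sinD2pi R) n.+1) subrK.
Qed.

Lemma continuous_cos_phase k : continuous (cos \o phase k).
Proof.
by move=> x; apply: continuous_comp; [exact: continuous_phase|exact: continuous_cos].
Qed.

Lemma continuous_sin_phase k : continuous (sin \o phase k).
Proof.
by move=> x; apply: continuous_comp; [exact: continuous_phase|exact: continuous_sin].
Qed.

Lemma partial_cos_phase k j x :
  partial j (cos \o phase k) x = - (2 * pi * (k ord0 j)%:~R) * sin (phase k x).
Proof.
have [_] := is_derive_phase j (is_derive_cos (phase k x)).
by rewrite /partial => ->; rewrite mulNr mulrC mulNr.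
Qed.

Lemma partial_sin_phase k j x :
  partial j (sin \o phase k) x = 2 * pi * (k ord0 j)%:~R * cos (phase k x).
Proof.
have [_] := is_derive_phase j (is_derive_sin (phase k x)).
by rewrite /partial => ->; rewrite mulrC.
Qed.

Lemma derivable_cos_phase k j x : derivable (cos \o phase k) x (e_ j).
Proof. by have [] := is_derive_phase j (is_derive_cos (phase k x)). Qed.

Lemma derivable_sin_phase k j x : derivable (sin \o phase k) x (e_ j).
Proof. by have [] := is_derive_phase j (is_derive_sin (phase k x)). Qed.

Lemma Cn_scale n (c : R) (f : 'rV[R]_d -> R) : Cn n f -> Cn n (c \*: f).
Proof.
elim: n f => [|n IH] f [cf Df]; split => //.
- by move=> x; exact: (continuous_comp (cf x) (@mulrl_continuous R c (f x))).
- by move=> x; exact: (continuous_comp (cf x) (@mulrl_continuous R c (f x))).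
- move=> j; have [df Cf] := Df j; split.
    by move=> x; apply: derivableZ; exact: df.
  rewrite (_ : partial j _ = c \*: partial j f); first exact: IH.
  by apply/funext => x; rewrite /partial deriveZ; last exact: df.
Qed.

(** A joint induction, since the partial derivatives of each are multiples of the other. *)
Lemma Cn_cos_sin_phase n k : Cn n (cos \o phase k) /\ Cn n (sin \o phase k).
Proof.
elim: n => [|n [IHc IHs]].
  by split; split => //; [exact: continuous_cos_phase|exact: continuous_sin_phase].
split; split.
- exact: continuous_cos_phase.
- move=> j; split; first by move=> x; exact: derivable_cos_phase.
  rewrite (_ : partial j _ = (- (2 * pi * (k ord0 j)%:~R)) \*: (sin \o phase k)).
    exact: Cn_scale.
  by apply/funext => x; rewrite partial_cos_phase.
- exact: continuous_sin_phase.
- move=> j; split; first by move=> x; exact: derivable_sin_phase.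
  rewrite (_ : partial j _ = (2 * pi * (k ord0 j)%:~R) \*: (cos \o phase k)).
    exact: Cn_scale.
  by apply/funext => x; rewrite partial_sin_phase.
Qed.

Lemma test_cos_phase k : test_function (cos \o phase k).
Proof.
split; last by move=> n; have [] := Cn_cos_sin_phase n k.
move=> x z /=; have [m ->] := phase_periodic k x z; exact: cos_periodicz.
Qed.

Lemma test_sin_phase k : test_function (sin \o phase k).
Proof.
split; last by move=> n; have [] := Cn_cos_sin_phase n k.
move=> x z /=; have [m ->] := phase_periodic k x z; exact: sin_periodicz.
Qed.

End phase.

(** * Integrable real functions and dominated convergence *)

Section integrable_real.
Context {dd : measure_display} {T : measurableType dd} {R : realType}.
Context (mu : {measure set T -> \bar R}).
Implicit Types f g : T -> R.
Local Notation integ f := (mu.-integrable setT (EFin \o f)).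

Lemma integrable_measurable_real f : integ f -> measurable_fun setT f.
Proof. by move=> /measurable_int/measurable_EFinP. Qed.

Lemma integrableD_real f g : integ f -> integ g -> integ (fun x => f x + g x).
Proof. by move=> If Ig; exact: (integrableD measurableT If Ig). Qed.

Lemma integrableZ_real (c : R) f : integ f -> integ (fun x => c * f x).
Proof. by move=> If; exact: (integrableZl measurableT c If). Qed.

Lemma integrableN_real f : integ f -> integ (fun x => - f x).
Proof. by move=> If; exact: (integrableN If). Qed.

Lemma integrable_norm_real f : integ f -> integ (fun x => `|f x|).
Proof. by move=> /integrable_norm; exact: eq_integrable. Qed.

Lemma integrable_mul_bounded f g (M : R) : integ f -> measurable_fun setT g ->
  {ae mu, forall x, `|g x| <= M} -> integ (fun x => f x * g x).
Proof.
move=> If mg gM.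
apply: (@ae_le_integrable _ _ _ mu _ (fun x => M * `|f x|)).
- exact: measurable_funM (integrable_measurable_real If) mg.
- apply: filterS gM => x gx.
  by rewrite normrM mulrC ler_wpM2r.
- exact/integrableZ_real/integrable_norm_real.
Qed.

Lemma eq_ae_integrable f g : measurable_fun setT g -> {ae mu, forall x, f x = g x} ->
  integ f -> integ g.
Proof.
move=> mg fg If; apply: (@ae_le_integrable _ _ _ mu _ (fun x => `|f x|)) => //.
- by apply: filterS fg => x ->.
- exact: integrable_norm_real.
Qed.

Lemma eq_ae_Rintegral f g : measurable_fun setT f -> measurable_fun setT g ->
  {ae mu, forall x, f x = g x} -> \int[mu]_x f x = \int[mu]_x g x.
Proof.
move=> mf mg fg; congr fine; apply: ae_eq_integral => //; [exact/measurable_EFinP..|].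
by apply: filterS fg => x -> _.
Qed.

Lemma Rintegral_dominated0 (f_ : nat -> T -> R) f g :
  (forall n, measurable_fun setT (f_ n)) -> measurable_fun setT f ->
  (forall x, f_ ^~ x @ \oo --> f x) -> integ g ->
  (forall n x, `|f_ n x| <= g x) ->
  (forall n, \int[mu]_x f_ n x = 0) -> \int[mu]_x f x = 0.
Proof.
move=> mf_ mf ff Ig fg i0.
have [] := @dominated_convergence _ _ _ mu setT measurableT
  (fun n => EFin \o f_ n) (EFin \o f) (EFin \o g).
- by move=> n; exact/measurable_EFinP.
- exact/measurable_EFinP.
- by apply: aeW => x _; apply/fine_cvgP; split; [exact: nearW|exact: ff].
- exact: Ig.
- by apply: aeW => x n _ /=; rewrite lee_fin.
move=> If _ /= L.
have i0' n : (\int[mu]_x (f_ n x)%:E = 0)%E.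
  have Ifn : integ (f_ n).
    by apply: (ae_le_integrable (mf_ n) _ Ig); apply: aeW => x; exact: fg.
  by rewrite -[LHS]fineK; [congr EFin; exact: i0|exact: integrable_fin_num Ifn].
rewrite /Rintegral (_ : (\int[mu]_x (f x)%:E = 0)%E)//.
have L0 : (fun n => (\int[mu]_x (f_ n x)%:E)%E) = cst 0%E by apply/funext.
have L' : (fun n => (\int[mu]_x (f_ n x)%:E)%E) @ \oo --> (\int[mu]_x (f x)%:E)%E := L.
by rewrite L0 in L'; apply: (cvg_unique _ L') => //; exact: cvg_cst.
Qed.

End integrable_real.

(** * Uniqueness of Fourier coefficients *)

Lemma bernoulli_ineq (R : realDomainType) (x : R) n : -1 <= x -> 1 + n%:R * x <= (1 + x) ^+ n.
Proof.
move=> x1; elim: n => [|n IH]; first by rewrite mul0r addr0 expr0.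
rewrite exprS; have : 0 <= 1 + x by lra.
move=> /ler_wpM2l /(_ _ _ IH); apply: le_trans.
rewrite -natr1; have : 0 <= n%:R * (x * x) by rewrite mulr_ge0// -expr2 sqr_ge0.
by lra.
Qed.

(** The midpoint w of z and 1 satisfies z <= w^2, because w^2 - z = ((1 - z) / 2)^2. Hence n z^n <=
    (n w^n) w^n, and Bernoulli's inequality for w^-1 = 1 + c bounds n w^n by c^-1. *)
Lemma cvg_nexpr (R : realType) (z : R) : 0 <= z < 1 -> n%:R * z ^+ n @[n --> \oo] --> 0.
Proof.
move=> /andP[z0 z1]; pose w := (1 + z) / 2.
have w0 : 0 < w by rewrite /w; lra.
have w1 : w < 1 by rewrite /w; lra.
have zw : z <= w ^+ 2.
  by have := sqr_ge0 ((1 - z) / 2); rewrite /w !expr2; lra.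
pose c := w^-1 - 1.
have c0 : 0 < c by rewrite subr_gt0 invf_gt1.
have wn : (fun n => c^-1 * w ^+ n) @ \oo --> 0.
  rewrite -(mulr0 c^-1); apply: cvgM; first exact: cvg_cst.
  by apply: cvg_expr; rewrite ger0_norm// ltW.
apply: (squeeze_cvgr _ (cvg_cst 0) wn); apply: nearW => n.
apply/andP; split; first by rewrite mulr_ge0// exprn_ge0.
have nw : n%:R * w ^+ n <= c^-1.
  rewrite -(ler_pM2l c0) mulfV ?gt_eqF// mulrA -ler_pdivlMr ?exprn_gt0// div1r -exprVn.
  have -> : w^-1 = 1 + c by rewrite /c; lra.
  by apply: le_trans (bernoulli_ineq _ _); [rewrite mulrC; lra|lra].
have := ler_wpM2r (exprn_ge0 n (ltW w0)) nw; apply: le_trans.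
rewrite -mulrA ler_wpM2l// -exprD addnn -mul2n exprM.
by rewrite lerXn2r// nnegrE// sqr_ge0.
Qed.

(** Polynomials in the manner of the Brosowski-Deutsch proof of the Stone-Weierstrass theorem. Below
    1/2, Bernoulli gives the lower bound 1 - n (2 y)^n. From 1/2 on, (1 - y^n)^m (1 + y^n)^m <= 1
    while (1 + y^n)^m >= 1 + m y^n >= n + 1. The factor n in the exponent m = n 2^n settles the
    threshold: at y = 1/2 the exponent 2^n alone would give the limit 1/e. *)
Lemma cvg_heaviside (R : realType) (y : R) : 0 <= y <= 1 ->
  (1 - y ^+ n) ^+ (n * 2 ^ n) @[n --> \oo] --> (((y < 2^-1)%R)%:R : R).
Proof.
move=> /andP[y0 y1].
have yn n : 0 <= y ^+ n <= 1 by rewrite exprn_ge0//= exprn_ile1.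
have [y2|y2] := ltP y 2^-1; rewrite /= ?mulr1n ?mulr0n.
  have z01 : 0 <= 2 * y < 1 by apply/andP; split; lra.
  have L : (fun n => 1 - n%:R * (2 * y) ^+ n) @ \oo --> (1 : R).
    rewrite -[X in _ --> X]subr0; apply: cvgB; first exact: cvg_cst.
    exact: cvg_nexpr.
  apply: (squeeze_cvgr (h := cst 1) _ L); [|exact: cvg_cst].
  apply: nearW => n.
  have /andP[yn0 yn1] := yn n.
  apply/andP; split; last by apply: exprn_ile1; lra.
  apply: le_trans (bernoulli_ineq _ _); last by lra.
  by rewrite mulrN lerD2l lerN2 exprMn natrM natrX mulrA.
apply: (squeeze_cvgr _ (cvg_cst 0) (@cvg_harmonic R)).
apply: nearW => n.
have /andP[yn0 yn1] := yn n.
apply/andP; split; first by apply: exprn_ge0; lra.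
set m := (n * 2 ^ n)%N.
have B : n.+1%:R <= (1 + y ^+ n) ^+ m.
  apply: le_trans (bernoulli_ineq _ _); last by lra.
  rewrite -natr1 addrC lerD2l /m natrM natrX -mulrA -exprMn ler_peMr//.
  by apply: exprn_ege1; lra.
have P : (1 - y ^+ n) ^+ m * (1 + y ^+ n) ^+ m <= 1.
  rewrite -exprMn; apply: exprn_ile1.
    by apply: mulr_ge0; lra.
  by have := sqr_ge0 (y ^+ n); rewrite expr2; lra.
rewrite /harmonic /= -[leRHS]div1r ler_pdivlMr ?ltr0n//; apply: le_trans P.
by apply: ler_wpM2l => //; apply: exprn_ge0; lra.
Qed.

Section uniqueness.
Context {R : realType} {d : nat}.
Local Notation vec := 'rV[R]_d.
Local Notation mu := (torus_measure R d).
Implicit Types (k l : 'rV[int]_d) (G : vec -> R).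
Local Notation integ f := (mu.-integrable setT (EFin \o f)).

(** Vanishing of all Fourier coefficients in real form, so that the real and imaginary parts of a
    complex function can be treated one at a time. *)
Definition trig_null G := integ G /\ forall k,
  \int[mu]_x (G x * cos (phase k x)) = 0 /\ \int[mu]_x (G x * sin (phase k x)) = 0.

Lemma measurable_cos_phase k : measurable_fun setT (fun x : vec => cos (phase k x)).
Proof. by have := continuous_measurable_rV (@continuous_cos_phase R d k). Qed.

Lemma measurable_sin_phase k : measurable_fun setT (fun x : vec => sin (phase k x)).
Proof. by have := continuous_measurable_rV (@continuous_sin_phase R d k). Qed.

Lemma integrable_mul_cos G k : integ G -> integ (fun x => G x * cos (phase k x)).
Proof.
move=> IG; apply: (@integrable_mul_bounded _ _ _ _ _ _ 1) => //.
  exact: measurable_cos_phase.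
by apply: aeW => x; exact: cos_max.
Qed.

Lemma integrable_mul_sin G k : integ G -> integ (fun x => G x * sin (phase k x)).
Proof.
move=> IG; apply: (@integrable_mul_bounded _ _ _ _ _ _ 1) => //.
  exact: measurable_sin_phase.
by apply: aeW => x; exact: sin_max.
Qed.

Lemma trig_nullD G1 G2 : trig_null G1 -> trig_null G2 -> trig_null (fun x => G1 x + G2 x).
Proof.
move=> [I1 H1] [I2 H2]; split; first exact: integrableD_real.
move=> k; have [c1 s1] := H1 k; have [c2 s2] := H2 k; split.
- under eq_Rintegral do rewrite mulrDl.
  by rewrite RintegralD// ?c1 ?c2 ?addr0//; exact: integrable_mul_cos.
- under eq_Rintegral do rewrite mulrDl.
  by rewrite RintegralD// ?s1 ?s2 ?addr0//; exact: integrable_mul_sin.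
Qed.

Lemma trig_nullZ (c : R) G : trig_null G -> trig_null (fun x => c * G x).
Proof.
move=> [I1 H1]; split; first exact: integrableZ_real.
move=> k; have [c1 s1] := H1 k; split.
- under eq_Rintegral do rewrite -mulrA.
  by rewrite RintegralZl// ?c1 ?mulr0//; exact: integrable_mul_cos.
- under eq_Rintegral do rewrite -mulrA.
  by rewrite RintegralZl// ?s1 ?mulr0//; exact: integrable_mul_sin.
Qed.

Lemma eq_trig_null G1 G2 : measurable_fun setT G2 -> {ae mu, forall x, G1 x = G2 x} ->
  trig_null G1 -> trig_null G2.
Proof.
move=> m2 G12 [I1 H1]; have I2 := eq_ae_integrable m2 G12 I1; split => // k.
have [c1 s1] := H1 k.
have m1 := integrable_measurable_real I1.
split; [rewrite -[RHS]c1|rewrite -[RHS]s1]; apply: eq_ae_Rintegral.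
- exact: measurable_funM m2 (measurable_cos_phase k).
- exact: measurable_funM m1 (measurable_cos_phase k).
- by apply: filterS G12 => x ->.
- exact: measurable_funM m2 (measurable_sin_phase k).
- exact: measurable_funM m1 (measurable_sin_phase k).
- by apply: filterS G12 => x ->.
Qed.

(** By the product-to-sum formulas, multiplication by a trigonometric function of frequency l only
    moves k to k + l and k - l, where the integrals vanish as well. *)
Lemma trig_null_cos G l : trig_null G -> trig_null (fun x => G x * cos (phase l x)).
Proof.
move=> [I1 H1]; split; first exact: integrable_mul_cos.
move=> k; have [c1 s1] := H1 (k + l); have [c2 s2] := H1 (k - l); split.
- transitivity (\int[mu]_x (2^-1 * (G x * cos (phase (k + l) x) + G x * cos (phase (k - l) x)))).
    by apply: eq_Rintegral => x _; rewrite phaseB phaseD cosD cosB; field.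
  rewrite RintegralZl//; last by apply: integrableD_real; exact: integrable_mul_cos.
  by rewrite RintegralD// ?c1 ?c2 ?addr0 ?mulr0//; exact: integrable_mul_cos.
- transitivity (\int[mu]_x (2^-1 * (G x * sin (phase (k + l) x) + G x * sin (phase (k - l) x)))).
    by apply: eq_Rintegral => x _; rewrite phaseB phaseD sinD sinB; field.
  rewrite RintegralZl//; last by apply: integrableD_real; exact: integrable_mul_sin.
  by rewrite RintegralD// ?s1 ?s2 ?addr0 ?mulr0//; exact: integrable_mul_sin.
Qed.

Lemma trig_null_sin G l : trig_null G -> trig_null (fun x => G x * sin (phase l x)).
Proof.
move=> [I1 H1]; split; first exact: integrable_mul_sin.
move=> k; have [c1 s1] := H1 (k + l); have [c2 s2] := H1 (k - l); split.
- transitivity (\int[mu]_x (2^-1 * (G x * sin (phase (k + l) x) + -1 * (G x * sin (phase (k - l) x))))).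
    by apply: eq_Rintegral => x _; rewrite phaseB phaseD sinD sinB; field.
  have I2 := integrable_mul_sin (k - l) I1.
  rewrite RintegralZl//; last first.
    by apply: integrableD_real; [exact: integrable_mul_sin|exact: integrableZ_real].
  rewrite RintegralD//; [|exact: integrable_mul_sin|exact: integrableZ_real].
  by rewrite RintegralZl// s1 s2 mulr0 addr0 mulr0.
- transitivity (\int[mu]_x (2^-1 * (G x * cos (phase (k - l) x) + -1 * (G x * cos (phase (k + l) x))))).
    by apply: eq_Rintegral => x _; rewrite phaseB phaseD cosB cosD; field.
  have I2 := integrable_mul_cos (k + l) I1.
  rewrite RintegralZl//; last first.
    by apply: integrableD_real; [exact: integrable_mul_cos|exact: integrableZ_real].
  rewrite RintegralD//; [|exact: integrable_mul_cos|exact: integrableZ_real].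
  by rewrite RintegralZl// c1 c2 mulr0 addr0 mulr0.
Qed.

(* below 1/2 exactly on the arc of centre [c] and half-width [r] of R/Z *)
Definition arc_bump (j : 'I_d) (c r : R) (x : vec) : R :=
  2^-1 - (cos (2 * pi * (x ord0 j - c)) - cos (2 * pi * r)) / 4.

(** A difference of two cosines lies in [-2, 2]; the divisor 4 keeps the bump within 1/2 of the
    threshold 1/2, as [cvg_heaviside] requires. *)
Lemma arc_bump_itv j c r x : 0 <= arc_bump j c r x <= 1.
Proof.
rewrite /arc_bump; set u := cos _; set v := cos _.
have := cos_geN1 (2 * pi * (x ord0 j - c)); have := cos_le1 (2 * pi * (x ord0 j - c)).
have := cos_geN1 (2 * pi * r); have := cos_le1 (2 * pi * r); rewrite -/u -/v.
by move=> *; apply/andP; split; lra.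
Qed.

Lemma measurable_arc_bump j c r : measurable_fun setT (arc_bump j c r).
Proof.
have E : arc_bump j c r = fun x => (2^-1 + cos (2 * pi * r) / 4) +
    (- cos (2 * pi * c) / 4) * cos (phase (delta_mx ord0 j) x) +
    (- sin (2 * pi * c) / 4) * sin (phase (delta_mx ord0 j) x).
  by apply/funext => x; rewrite /arc_bump phase_delta (mulrBr (2 * pi)) cosB; field.
rewrite E; apply: measurable_funD; first apply: measurable_funD => //.
- by apply: measurable_funM => //; exact: measurable_cos_phase.
- by apply: measurable_funM => //; exact: measurable_sin_phase.
Qed.

(** The addition formula makes the bump an affine combination of the cosine and the sine of
    frequency e_j. *)
Lemma trig_null_arc_bump G j c r : trig_null G -> trig_null (fun x => G x * arc_bump j c r x).
Proof.
move=> HG.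
rewrite (_ : (fun x => _) = fun x => (2^-1 + cos (2 * pi * r) / 4) * G x +
    ((- cos (2 * pi * c) / 4) * (G x * cos (phase (delta_mx ord0 j) x)) +
    (- sin (2 * pi * c) / 4) * (G x * sin (phase (delta_mx ord0 j) x)))).
  apply: trig_nullD; first exact: trig_nullZ.
  by apply: trig_nullD; apply: trig_nullZ; [exact: trig_null_cos|exact: trig_null_sin].
by apply/funext => x; rewrite /arc_bump phase_delta (mulrBr (2 * pi)) cosB; field.
Qed.

Lemma trig_null_step G j c r (n m : nat) : trig_null G ->
  trig_null (fun x => G x * (1 - arc_bump j c r x ^+ n) ^+ m).
Proof.
have HX G' p : trig_null G' -> trig_null (fun x => G' x * arc_bump j c r x ^+ p).
  move=> HG'; elim: p => [|p IH].
    by rewrite (_ : (fun x => _) = G')//; apply/funext => x; rewrite expr0 mulr1.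
  rewrite (_ : (fun x => _) = fun x => (G' x * arc_bump j c r x ^+ p) * arc_bump j c r x).
    exact: trig_null_arc_bump.
  by apply/funext => x; rewrite exprSr mulrA.
move=> HG; elim: m => [|m IH].
  by rewrite (_ : (fun x => _) = G)//; apply/funext => x; rewrite expr0 mulr1.
set F := (fun x => G x * (1 - arc_bump j c r x ^+ n) ^+ m) in IH.
rewrite (_ : (fun x => _) = fun x => F x + -1 * (F x * arc_bump j c r x ^+ n)).
  by apply: trig_nullD => //; apply/trig_nullZ/HX.
by apply/funext => x; rewrite exprSr /F; ring.
Qed.

Lemma trig_null_arc G j c r : trig_null G ->
  trig_null (fun x => G x * (arc_bump j c r x < 2^-1)%R%:R).
Proof.
move=> HG; have [IG _] := HG.
have mG := integrable_measurable_real IG.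
have mb := measurable_arc_bump j c r.
have mi : measurable_fun setT (fun x => ((arc_bump j c r x < 2^-1)%R%:R : R)).
  rewrite (_ : (fun x => _) = \1_([set x | arc_bump j c r x < 2^-1])).
    apply: measurable_indic.
    have := mb measurableT `]-oo, 2^-1[%classic (measurable_itv _).
    by rewrite setTI preimage_itvNyo.
  by apply/funext => x; rewrite indicE; congr (nat_of_bool _)%:R; apply/idP/idP; rewrite inE.
have cv x : (fun n => (1 - arc_bump j c r x ^+ n) ^+ (n * 2 ^ n)) @ \oo -->
    ((arc_bump j c r x < 2^-1)%R%:R : R) by apply: cvg_heaviside; exact: arc_bump_itv.
split.
  apply: (@integrable_mul_bounded _ _ _ _ _ _ 1) => //.
  by apply: aeW => x /=; case: (_ < _) => /=; rewrite ?normr1 ?normr0.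
have b1 x n : `|(1 - arc_bump j c r x ^+ n) ^+ (n * 2 ^ n)| <= 1.
  have /andP[b0 b1] := arc_bump_itv j c r x.
  have bn0 : 0 <= arc_bump j c r x ^+ n by rewrite exprn_ge0.
  have bn1 : arc_bump j c r x ^+ n <= 1 by rewrite exprn_ile1.
  rewrite ger0_norm; first by apply: exprn_ile1; lra.
  by apply: exprn_ge0; lra.
have mp n : measurable_fun setT (fun x => (1 - arc_bump j c r x ^+ n) ^+ (n * 2 ^ n)).
  by apply: measurable_funX; apply: measurable_funB => //; exact: measurable_funX.
(* [q] stands for the cosine or the sine of a phase. The other two factors being at most 1 in
   absolute value, |G| dominates. *)
have conv (q : vec -> R) : measurable_fun setT q -> (forall x, `|q x| <= 1) ->
    (forall n, \int[mu]_x (G x * (1 - arc_bump j c r x ^+ n) ^+ (n * 2 ^ n) * q x) = 0) ->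
    \int[mu]_x (G x * (arc_bump j c r x < 2^-1)%R%:R * q x) = 0.
  move=> mq q1 qn.
  apply: (@Rintegral_dominated0 _ _ _ mu _ _ (fun x => `|G x|) _ _ _ _ _ qn).
  - by move=> n; apply: measurable_funM mq; exact: measurable_funM.
  - by apply: measurable_funM mq; exact: measurable_funM.
  - move=> x; apply: cvgM; last exact: cvg_cst.
    by apply: cvgM; [exact: cvg_cst|exact: cv].
  - exact: integrable_norm_real.
  - move=> n x; rewrite !normrM -[leRHS]mulr1 -[leRHS]mulr1.
    by rewrite !ler_pM ?mulr_ge0.
move=> k; split; apply: conv.
- exact: measurable_cos_phase.
- by move=> x; exact: cos_max.
- by move=> n; have [_ /(_ k)[]] := trig_null_step j c r n (n * 2 ^ n) HG.
- exact: measurable_sin_phase.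
- by move=> x; exact: sin_max.
- by move=> n; have [_ /(_ k)[]] := trig_null_step j c r n (n * 2 ^ n) HG.
Qed.

(** The arc with centre (1 + c) / 2 and half-width (1 - c) / 2 is ]c, 1[. Comparing cosines requires
    angles in [0, pi], where cos decreases. So the offset t from the centre is used as it is when t
    >= 0, replaced by -t by parity when -1/2 <= t < 0, and by 1 + t by periodicity when t < -1/2. *)
Lemma arc_bump_lt_half j (c : R) (x : vec) : 0 <= c < 1 -> 0 < x ord0 j < 1 ->
  (arc_bump j ((1 + c) / 2) ((1 - c) / 2) x < 2^-1) = (c < x ord0 j).
Proof.
move=> /andP[c0 c1] /andP[x_gt0 x1]; rewrite /arc_bump.
set t := x ord0 j - (1 + c) / 2; set r := (1 - c) / 2.
have pi0 := @pi_gt0 R.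
have P (s : R) : (2 * pi * s \in `[0, pi]) = (0 <= s <= 2^-1).
  rewrite in_itv/= pmulr_rge0 ?mulr_gt0//; congr (_ && _).
  by rewrite mulrAC -ler_pdivlMr// mulfV ?gt_eqF// mulrC -ler_pdivlMr// div1r.
have r2 : 0 <= r <= 2^-1 by rewrite /r; apply/andP; split; lra.
have -> : (2^-1 - (cos (2 * pi * t) - cos (2 * pi * r)) / 4 < 2^-1) =
    (cos (2 * pi * r) < cos (2 * pi * t)).
  by apply/idP/idP => h; lra.
have [t0|t0] := leP 0 t.
  have t2 : 0 <= t <= 2^-1 by apply/andP; split => //; rewrite /t; lra.
  rewrite ltr_cos ?P// ltr_pM2l ?mulr_gt0//.
  by rewrite /t /r; apply/idP/idP => h; [move: t0; rewrite /t; lra|lra].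
rewrite -(cosN (2 * pi * t)) -mulrN.
have [t2|t2] := leP (- t) 2^-1.
  rewrite ltr_cos ?P//; last by apply/andP; split; lra.
  rewrite ltr_pM2l ?mulr_gt0//.
  by rewrite /t /r; apply/idP/idP => h; lra.
have -> : cos (2 * pi * - t) = cos (2 * pi * (1 + t)).
  rewrite -cosN -(cosD2pi (- _)); congr cos; rewrite -mulr_natl; ring.
have t12 : 0 <= 1 + t <= 2^-1 by apply/andP; split; [rewrite /t; lra|lra].
rewrite ltr_cos ?P// ltr_pM2l ?mulr_gt0//.
by move: t2; rewrite /t /r => t2; apply/idP/idP => h; lra.
Qed.

Lemma measurable_ray j (c : R) :
  measurable_fun setT (fun x : vec => ((c < x ord0 j)%R%:R : R)).
Proof.
rewrite (_ : (fun x => _) = \1_([set x : vec | c < x ord0 j])).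
  apply: measurable_indic.
  have := measurable_coord j measurableT (measurable_itv `]c, +oo[).
  by rewrite setTI preimage_itvoy.
by apply/funext => x; rewrite indicE; congr (nat_of_bool _)%:R; apply/idP/idP; rewrite inE.
Qed.

(** Seen from the cube, up to null sets, the ray is everything for c < 0, the arc ]c, 1[ for 0 <= c
    < 1, and empty for c >= 1. *)
Lemma trig_null_ray G j (c : R) : trig_null G ->
  trig_null (fun x => G x * (c < x ord0 j)%R%:R).
Proof.
move=> HG; have mG := integrable_measurable_real HG.1.
have mray := measurable_funM mG (measurable_ray j c).
have [c0|c0] := ltP c 0.
  apply: eq_trig_null HG => //; apply: filterS (@ae_unit_open_cube R d) => x xP.
  have /andP[x0 _] := xP j.
  by rewrite (lt_trans c0 x0) mulr1.
have [c1|c1] := ltP c 1.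
  apply: eq_trig_null (trig_null_arc j ((1 + c) / 2) ((1 - c) / 2) HG) => //.
  apply: filterS (@ae_unit_open_cube R d) => x xP.
  by rewrite arc_bump_lt_half// c0.
apply: eq_trig_null (trig_nullZ 0 HG) => //.
apply: filterS (@ae_unit_open_cube R d) => x xP.
by have /andP[_ x1] := xP j; rewrite ltNge (le_trans (ltW x1) c1) mulr0 mul0r.
Qed.

(** The pi-system for Dynkin's argument: two such boxes meet in the box of the coordinatewise
    maxima. *)
Definition upper_box (c : 'I_d -> R) := [set x : vec | forall j, c j < x ord0 j].

Lemma measurable_upper_box c : measurable (upper_box c).
Proof.
rewrite (_ : upper_box c = [set x : vec | forall j, `]c j, +oo[%classic (x ord0 j)]).
  exact: (@measurable_rV_box R d (fun j => `]c j, +oo[%classic)).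
by apply/seteqP; split => x /= xc j; have := xc j; rewrite /= in_itv /= andbT.
Qed.

(** The indicator of the box is a product of ray indicators, each of which preserves [trig_null];
    the integral is then the coefficient at frequency 0. *)
Lemma integral_upper_box G c : trig_null G ->
  (\int[mu]_(x in upper_box c) (G x)%:E = 0)%E.
Proof.
move=> HG.
have H (s : seq 'I_d) : trig_null (fun x => G x * \prod_(j <- s) (c j < x ord0 j)%R%:R).
  elim: s => [|j s IH].
    by rewrite (_ : (fun x => _) = G)//; apply/funext => x; rewrite big_nil mulr1.
  rewrite (_ : (fun x => _) =
      fun x => (G x * \prod_(j <- s) (c j < x ord0 j)%R%:R) * (c j < x ord0 j)%R%:R).
    exact: trig_null_ray.
  by apply/funext => x; rewrite big_cons mulrCA mulrC.
have [I1 /(_ 0)[+ _]] := H (index_enum 'I_d).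
under eq_Rintegral do rewrite phase0 cos0 mulr1.
rewrite integral_mkcond => i0.
rewrite -[LHS]fineK; last first.
  have mb : measurable (upper_box c).
    exact: measurable_upper_box.
  apply: integrable_fin_num => //; apply/integrable_restrict => //; rewrite setTI.
  exact: integrableS HG.1.
congr EFin; rewrite -[RHS]i0 /Rintegral; congr fine; apply: eq_integral => x _.
rewrite patchE; case: ifPn => [|/negP] xc.
  rewrite inE in xc; rewrite big1 ?mulr1// => j _.
  by rewrite xc.
have [j jc] : exists j, ~~ (c j < x ord0 j).
  apply: contrapT => /forallNP nj; apply: xc; rewrite inE => j.
  by have /negP := nj j; rewrite negbK.
by rewrite (bigD1 j)//= (negbTE jc) mul0r mulr0.
Qed.

Lemma measurable_rV_upper_box :
  measurable = <<s [set A | exists c, A = upper_box c] >> :> set (set vec).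
Proof.
set Gen := [set A | exists c, A = upper_box c].
have mc i : measurable_fun [set: g_sigma_algebraType Gen]
    (fun x : g_sigma_algebraType Gen => (x : vec) ord0 i).
  apply: (measurability _ (RGenOInfty.measurableE R)) => _ [_ [a ->] <-].
  rewrite setTI preimage_itvoy.
  (* The half-space x_i > a is exhausted by boxes whose other bounds are -n. *)
  rewrite (_ : [set x | _] = \bigcup_n upper_box (fun j => if j == i then a else - n%:R)).
    by apply: bigcupT_measurable => n; apply: sub_sigma_algebra; eexists.
  apply/seteqP; split => [x /= ax|x /= [n _ /(_ i)]]; last by rewrite eqxx.
  have [m mP] : exists m : nat, forall j, - m%:R < (x : vec) ord0 j.
    exists (Num.bound (\sum_j `|(x : vec) ord0 j|)) => j.
    rewrite ltrNl; apply: le_lt_trans (archi_boundP _); last exact: sumr_ge0.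
    rewrite (bigD1 j)//= -[leLHS]addr0 lerD ?sumr_ge0//.
    by rewrite -normrN ler_norm.
  by exists m => // j; case: eqP => [->|].
apply/seteqP; split; last first.
  apply: smallest_sub => //; first exact: sigma_algebra_measurable.
  move=> _ [c ->].
  exact: measurable_upper_box.
apply: smallest_sub; first exact: smallest_sigma_algebra.
rewrite -bigcup_seq => _ [i _ [B mB <-]].
exact: (mc i measurableT B mB).
Qed.

Theorem trig_null_ae0 G : trig_null G -> {ae mu, forall x, G x = 0}.
Proof.
move=> HG; have IG := HG.1.
(* The whole space is handled by frequency 0; complements in Dynkin's argument rely on it. *)
have iT : (\int[mu]_x (G x)%:E = 0)%E.
  have [_ /(_ 0)[+ _]] := HG.
  under eq_Rintegral do rewrite phase0 cos0 mulr1.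
  by move=> i0; rewrite -[LHS]fineK; [congr EFin|exact: integrable_fin_num IG].
have i0 A : measurable A -> (\int[mu]_(x in A) (G x)%:E = 0)%E.
  pose Gen := [set A | exists c, A = upper_box c].
  rewrite measurable_rV_upper_box.
  apply: (@dynkin_induction _ _ Gen (fun A => (\int[mu]_(x in A) (G x)%:E = 0)%E)).
  - exact: measurable_rV_upper_box.
  - move=> _ _ [c ->] [c' ->]; exists (fun j => Num.max (c j) (c' j)).
    apply/seteqP; split => x /=.
      by move=> [xc xc'] j; rewrite gt_max xc xc'.
    by move=> xc; split => j; have := xc j; rewrite gt_max => /andP[].
  - exact: iT.
  - by move=> _ [c ->]; exact: integral_upper_box.
  - move=> S mS S0; rewrite -iT -(setUv S) integral_setU ?setUv//.
    + by rewrite S0 add0e.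
    + exact: measurableC.
    + exact: measurable_int IG.
    + by rewrite disj_set2E setICr.
  - move=> F mF tF F0; rewrite integral_bigcup//.
      by rewrite eseries0.
    by apply: integrableS IG => //; exact: bigcupT_measurable.
have : ae_eq mu setT (EFin \o G) (cst 0%E).
  apply: integral_ae_eq => // E _ mE.
  by rewrite integral0 i0.
by apply: filterS => x /(_ I)[].
Qed.

End uniqueness.

(** * Complex integrals, Fourier coefficients and Bessel's inequality *)

Section complex_parts.
Context (R : realType).
Implicit Types z w : R[i].
Local Notation Re := complex.Re.
Local Notation Im := complex.Im.

Lemma ReM z w : Re (z * w) = Re z * Re w - Im z * Im w.
Proof. by case: z w => [a b] [c e]. Qed.

Lemma ImM z w : Im (z * w) = Re z * Im w + Im z * Re w.
Proof. by case: z w => [a b] [c e]. Qed.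

Lemma ReD z w : Re (z + w) = Re z + Re w.
Proof. by case: z w => [a b] [c e]. Qed.

Lemma ImD z w : Im (z + w) = Im z + Im w.
Proof. by case: z w => [a b] [c e]. Qed.

Lemma ReN z : Re (- z) = - Re z.
Proof. by case: z. Qed.

Lemma ImN z : Im (- z) = - Im z.
Proof. by case: z. Qed.

Lemma Re_conj z : Re (z^*) = Re z.
Proof. by case: z. Qed.

Lemma Im_conj z : Im (z^*) = - Im z.
Proof. by case: z. Qed.

Lemma complex_eqP z w : Re z = Re w -> Im z = Im w -> z = w.
Proof. by case: z w => [a b] [c e] /= -> ->. Qed.

Lemma sqr_modulus z : modulus z ^+ 2 = Re z ^+ 2 + Im z ^+ 2.
Proof. by case: z => a b; rewrite /modulus /= sqr_sqrtr// addr_ge0// sqr_ge0. Qed.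

Lemma Re_sum (I : Type) (s : seq I) (F : I -> R[i]) :
  Re (\sum_(i <- s) F i) = \sum_(i <- s) Re (F i).
Proof. by elim: s => [|i s IH]; rewrite ?big_nil// !big_cons ReD IH. Qed.

Lemma modulus_ge0 z : 0 <= modulus z.
Proof. by case: z => a b; exact: sqrtr_ge0. Qed.

End complex_parts.

Section cintegral.
Context {R : realType} {d : nat}.
Local Notation vec := 'rV[R]_d.
Local Notation mu := (torus_measure R d).
Local Notation integ f := (mu.-integrable setT (EFin \o f)).
Local Notation Re := complex.Re.
Local Notation Im := complex.Im.
Implicit Types (g h : vec -> R[i]) (c : R[i]).

Definition cintegrable g := integ (fun x => Re (g x)) /\ integ (fun x => Im (g x)).

Lemma cintegrable_measurable g : cintegrable g -> cmeasurable g.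
Proof.
move=> [Ir Ii]; split; [exact: integrable_measurable_real Ir|].
exact: integrable_measurable_real Ii.
Qed.

Lemma cintegrableD g h : cintegrable g -> cintegrable h -> cintegrable (fun x => g x + h x).
Proof.
move=> [gr gi] [hr hi]; split.
- by under eq_fun do rewrite ReD; exact: integrableD_real.
- by under eq_fun do rewrite ImD; exact: integrableD_real.
Qed.

Lemma cintegralD g h : cintegrable g -> cintegrable h ->
  cintegral (fun x => g x + h x) = cintegral g + cintegral h.
Proof.
move=> [gr gi] [hr hi]; apply: complex_eqP; rewrite ?ReD ?ImD /=.
- by under eq_Rintegral do rewrite ReD; rewrite RintegralD.
- by under eq_Rintegral do rewrite ImD; rewrite RintegralD.
Qed.

Lemma cintegrableZ c g : cintegrable g -> cintegrable (fun x => c * g x).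
Proof.
move=> [gr gi]; split.
- under eq_fun do rewrite ReM -mulNr.
  by apply: integrableD_real; exact: integrableZ_real.
- under eq_fun do rewrite ImM.
  by apply: integrableD_real; exact: integrableZ_real.
Qed.

Lemma cintegralZ c g : cintegrable g -> cintegral (fun x => c * g x) = c * cintegral g.
Proof.
move=> [gr gi]; apply: complex_eqP; rewrite ?ReM ?ImM /=.
- under eq_Rintegral do rewrite ReM -mulNr.
  by rewrite RintegralD ?RintegralZl ?mulNr//; exact: integrableZ_real.
- under eq_Rintegral do rewrite ImM.
  by rewrite RintegralD ?RintegralZl//; exact: integrableZ_real.
Qed.

Lemma cintegrableN g : cintegrable g -> cintegrable (fun x => - g x).
Proof. by move=> /(cintegrableZ (-1)); under eq_fun do rewrite mulN1r. Qed.

Lemma cintegralN g : cintegrable g -> cintegral (fun x => - g x) = - cintegral g.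
Proof. by move=> /(cintegralZ (-1)); rewrite mulN1r; under eq_fun do rewrite mulN1r. Qed.

Lemma cintegralB g h : cintegrable g -> cintegrable h ->
  cintegral (fun x => g x - h x) = cintegral g - cintegral h.
Proof. by move=> Ig Ih; rewrite cintegralD ?cintegralN//; exact: cintegrableN. Qed.

Lemma cintegrable0 : cintegrable (fun _ : vec => 0).
Proof. by split; exact: (finite_measure_integrable_cst mu 0 measurableT). Qed.

Lemma cintegrable_sum (I : eqType) (s : seq I) (F : I -> vec -> R[i]) :
  (forall i, i \in s -> cintegrable (F i)) -> cintegrable (fun x => \sum_(i <- s) F i x).
Proof.
elim: s => [|i s IH] IF.
  by under eq_fun do rewrite big_nil; exact: cintegrable0.
under eq_fun do rewrite big_cons.
apply: cintegrableD; first by apply: IF; rewrite mem_head.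
by apply: IH => j js; apply: IF; rewrite inE js orbT.
Qed.

Lemma cintegral0 : cintegral (fun _ : vec => 0 : R[i]) = 0.
Proof.
apply: complex_eqP => /=; rewrite /Rintegral integral0_eq//.
Qed.

Lemma cintegral_sum (I : eqType) (s : seq I) (F : I -> vec -> R[i]) :
  (forall i, i \in s -> cintegrable (F i)) ->
  cintegral (fun x => \sum_(i <- s) F i x) = \sum_(i <- s) cintegral (F i).
Proof.
elim: s => [|i s IH] IF.
  by under eq_fun do rewrite big_nil; rewrite big_nil cintegral0.
under eq_fun do rewrite big_cons; rewrite big_cons cintegralD ?IH//.
- by move=> j js; apply: IF; rewrite inE js orbT.
- by apply: IF; rewrite mem_head.
- by apply: cintegrable_sum => j js; apply: IF; rewrite inE js orbT.
Qed.

Lemma cintegral_conj g : cintegrable g -> cintegral (fun x => (g x)^*) = (cintegral g)^*.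
Proof.
move=> [gr gi]; apply: complex_eqP; rewrite ?Re_conj ?Im_conj /=.
- by under eq_Rintegral do rewrite Re_conj.
- under eq_Rintegral do rewrite Im_conj -mulN1r.
  by rewrite RintegralZl// mulN1r.
Qed.

Lemma eq_ae_cintegral g h : cmeasurable g -> cmeasurable h ->
  {ae mu, forall x, g x = h x} -> cintegral g = cintegral h.
Proof.
move=> [mgr mgi] [mhr mhi] gh; apply: complex_eqP => /=; apply: eq_ae_Rintegral => //;
  by apply: filterS gh => x ->.
Qed.

Lemma cmeasurableM g h : cmeasurable g -> cmeasurable h -> cmeasurable (fun x => g x * h x).
Proof.
move=> [mgr mgi] [mhr mhi]; split.
- by under eq_fun do rewrite ReM; apply: measurable_funB; exact: measurable_funM.
- by under eq_fun do rewrite ImM; apply: measurable_funD; exact: measurable_funM.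
Qed.

Lemma cmeasurableD g h : cmeasurable g -> cmeasurable h -> cmeasurable (fun x => g x + h x).
Proof.
move=> [mgr mgi] [mhr mhi]; split.
- by under eq_fun do rewrite ReD; exact: measurable_funD.
- by under eq_fun do rewrite ImD; exact: measurable_funD.
Qed.

Lemma cmeasurable_cst c : cmeasurable (fun _ : vec => c).
Proof. by split; exact: measurable_cst. Qed.

Lemma cmeasurable_conj g : cmeasurable g -> cmeasurable (fun x => (g x)^*).
Proof.
move=> [mgr mgi]; split.
- by under eq_fun do rewrite Re_conj.
- by under eq_fun do rewrite Im_conj; exact: measurable_funN.
Qed.

Lemma cmeasurable_real (f : vec -> R) : measurable_fun setT f -> cmeasurable (to_complex f).
Proof. by move=> mf; split => //; exact: measurable_cst. Qed.

End cintegral.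

(** * Square-integrable functions and trigonometric polynomials *)

Section square_integrable.
Context {R : realType} {d : nat}.
Local Notation vec := 'rV[R]_d.
Local Notation mu := (torus_measure R d).
Local Notation integ f := (mu.-integrable setT (EFin \o f)).
Local Notation Re := complex.Re.
Local Notation Im := complex.Im.
Implicit Types (g h : vec -> R[i]) (c : R[i]) (k l : 'rV[int]_d).

(** The squared modulus ([sqr_modulus]) as a polynomial in the two parts, within reach of [ring] and
    [lra]. *)
Definition sqn (z : R[i]) : R := Re z ^+ 2 + Im z ^+ 2.

Lemma sqn_ge0 z : 0 <= sqn z.
Proof. by rewrite addr_ge0// sqr_ge0. Qed.

Lemma sqnM z w : sqn (z * w) = sqn z * sqn w.
Proof. by rewrite /sqn ReM ImM; ring. Qed.

Lemma sqn_conj z : sqn (z^*) = sqn z.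
Proof. by rewrite /sqn Re_conj Im_conj sqrrN. Qed.

Lemma sqnD_le z w : sqn (z + w) <= 2 * sqn z + 2 * sqn w.
Proof.
rewrite /sqn ReD ImD.
by have := sqr_ge0 (Re z - Re w); have := sqr_ge0 (Im z - Im w); lra.
Qed.

Lemma mul_conj_sqn z : z * z^* = (sqn z)%:C%C.
Proof.
by apply: complex_eqP; rewrite ?ReM ?ImM Re_conj Im_conj /= /sqn; ring.
Qed.

Lemma Re_mul_conj_le z w : `|Re (z * w^*)| <= sqn z + sqn w.
Proof.
rewrite ReM Re_conj Im_conj /sqn ler_norml.
have := sqr_ge0 (Re z - Re w); have := sqr_ge0 (Im z - Im w).
have := sqr_ge0 (Re z + Re w); have := sqr_ge0 (Im z + Im w).
have := sqr_ge0 (Re z); have := sqr_ge0 (Re w); have := sqr_ge0 (Im z); have := sqr_ge0 (Im w).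
by move=> *; apply/andP; split; lra.
Qed.

Lemma Im_mul_conj_le z w : `|Im (z * w^*)| <= sqn z + sqn w.
Proof.
rewrite ImM Re_conj Im_conj /sqn ler_norml.
have := sqr_ge0 (Re z - Im w); have := sqr_ge0 (Im z - Re w).
have := sqr_ge0 (Re z + Im w); have := sqr_ge0 (Im z + Re w).
have := sqr_ge0 (Re z); have := sqr_ge0 (Re w); have := sqr_ge0 (Im z); have := sqr_ge0 (Im w).
by move=> *; apply/andP; split; lra.
Qed.

(** The analytic half of [inLp] for exponent 2, the other half being periodicity ([inLp2P]). *)
Definition sq_integrable g := cmeasurable g /\ integ (fun x => sqn (g x)).

Lemma measurable_sqn g : cmeasurable g -> measurable_fun setT (fun x => sqn (g x)).
Proof. by move=> [mr mi]; apply: measurable_funD; exact: measurable_funX. Qed.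

Lemma sq_integrable_cintegrableM g h : sq_integrable g -> sq_integrable h ->
  cintegrable (fun x => g x * (h x)^*).
Proof.
move=> [mg Ig] [mh Ih]; have [mr mi] := cmeasurableM mg (cmeasurable_conj mh).
split; apply: (ae_le_integrable _ _ (integrableD_real Ig Ih)) => //; apply: aeW => x.
- exact: Re_mul_conj_le.
- exact: Im_mul_conj_le.
Qed.

Lemma sq_integrableD g h : sq_integrable g -> sq_integrable h -> sq_integrable (fun x => g x + h x).
Proof.
move=> [mg Ig] [mh Ih]; have mgh := cmeasurableD mg mh; split => //.
apply: (@ae_le_integrable _ _ _ _ _ (fun x => 2 * sqn (g x) + 2 * sqn (h x))).
- exact: measurable_sqn.
- by apply: aeW => x; rewrite ger0_norm ?sqn_ge0//; exact: sqnD_le.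
- by apply: integrableD_real; exact: integrableZ_real.
Qed.

Lemma sq_integrable_mul_bounded g h (M : R) : cmeasurable h -> {ae mu, forall x, sqn (h x) <= M} ->
  sq_integrable g -> sq_integrable (fun x => h x * g x).
Proof.
move=> mh hM [mg Ig]; have mgh := cmeasurableM mh mg; split => //.
apply: (@ae_le_integrable _ _ _ _ _ (fun x => M * sqn (g x))).
- exact: measurable_sqn.
- by apply: filterS hM => x hx; rewrite ger0_norm ?sqn_ge0// sqnM ler_wpM2r ?sqn_ge0.
- exact: integrableZ_real.
Qed.

Lemma sq_integrableZ c g : sq_integrable g -> sq_integrable (fun x => c * g x).
Proof.
by apply: (@sq_integrable_mul_bounded _ _ (sqn c)); [exact: cmeasurable_cst|exact: aeW].
Qed.

Lemma sq_integrableB g h : sq_integrable g -> sq_integrable h -> sq_integrable (fun x => g x - h x).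
Proof.
move=> Ig /(sq_integrableZ (-1)) Ih.
by under eq_fun do rewrite -mulN1r; exact: sq_integrableD.
Qed.

Lemma sq_integrable_bounded h (M : R) : cmeasurable h -> (forall x, sqn (h x) <= M) -> sq_integrable h.
Proof.
move=> mh hM; split => //.
apply: (@ae_bounded_integrable _ _ _ _ _ M); first exact: measurable_sqn.
by apply: aeW => x; rewrite ger0_norm ?sqn_ge0.
Qed.

Lemma sq_integrable_cst c : sq_integrable (fun _ : vec => c).
Proof. by apply: (@sq_integrable_bounded _ (sqn c)) => //; exact: cmeasurable_cst. Qed.

Lemma sq_integrable_cintegrable g : sq_integrable g -> cintegrable g.
Proof.
move=> /sq_integrable_cintegrableM /(_ (sq_integrable_cst 1)).
by under eq_fun do rewrite rmorph1 mulr1.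
Qed.

Lemma sq_integrable_sum (I : eqType) (s : seq I) (F : I -> vec -> R[i]) :
  (forall i, i \in s -> sq_integrable (F i)) -> sq_integrable (fun x => \sum_(i <- s) F i x).
Proof.
elim: s => [|i s IH] IF.
  by under eq_fun do rewrite big_nil; exact: sq_integrable_cst.
under eq_fun do rewrite big_cons.
apply: sq_integrableD; first by apply: IF; rewrite mem_head.
by apply: IH => j js; apply: IF; rewrite inE js orbT.
Qed.

Lemma Re_echar k (x : vec) : Re (echar k x) = cos (phase k x).
Proof. by []. Qed.

Lemma Im_echar k (x : vec) : Im (echar k x) = sin (phase k x).
Proof. by []. Qed.

Lemma echarD k l (x : vec) : echar (k + l) x = echar k x * echar l x.
Proof.
by apply: complex_eqP; rewrite ?ReM ?ImM !Re_echar !Im_echar phaseD ?cosD ?sinD; ring.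
Qed.

Lemma echar_conj k (x : vec) : (echar k x)^* = echar (- k) x.
Proof.
by apply: complex_eqP; rewrite ?Re_conj ?Im_conj ?Re_echar ?Im_echar phaseN ?cosN ?sinN.
Qed.

Lemma echar0 (x : vec) : echar 0 x = 1.
Proof. by apply: complex_eqP; rewrite ?Re_echar ?Im_echar phase0 ?cos0 ?sin0. Qed.

Lemma sqn_echar k (x : vec) : sqn (echar k x) = 1.
Proof. by rewrite /sqn Re_echar Im_echar cos2Dsin2. Qed.

Lemma echar_periodic k : Defs.periodic (@echar R d k).
Proof.
move=> x z; have [m xm] := phase_periodic k x z.
by apply: complex_eqP; rewrite ?Re_echar ?Im_echar xm ?cos_periodicz ?sin_periodicz.
Qed.

Lemma cmeasurable_echar k : cmeasurable (@echar R d k).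
Proof. by split; [exact: measurable_cos_phase|exact: measurable_sin_phase]. Qed.

Lemma sq_integrable_echar k : sq_integrable (@echar R d k).
Proof.
apply: (@sq_integrable_bounded _ 1); first exact: cmeasurable_echar.
by move=> x; rewrite sqn_echar.
Qed.

Lemma sq_integrable_mul_echar k g : sq_integrable g -> sq_integrable (fun x => echar k x * g x).
Proof.
apply: (@sq_integrable_mul_bounded _ _ 1); first exact: cmeasurable_echar.
by apply: aeW => x; rewrite sqn_echar.
Qed.

Implicit Types b : 'rV[int]_d -> R[i].

(** Frequencies are listed, with repetitions allowed; [uniq] is asked for where coefficients are
    read off. *)
Definition tpoly (s : seq 'rV[int]_d) (b : 'rV[int]_d -> R[i]) (x : vec) : R[i] :=
  \sum_(k <- s) b k * echar k x.

Lemma sq_integrable_tpoly s b : sq_integrable (tpoly s b).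
Proof. by apply: sq_integrable_sum => k _; apply/sq_integrableZ/sq_integrable_echar. Qed.

Lemma tpoly_periodic s b : Defs.periodic (tpoly s b).
Proof. by move=> x z; apply: eq_bigr => k _; rewrite echar_periodic. Qed.

Lemma cintegrable_fcoef g k : sq_integrable g -> cintegrable (fun x => g x * (echar k x)^*).
Proof. by move=> Ig; apply: sq_integrable_cintegrableM => //; exact: sq_integrable_echar. Qed.

Lemma fcoefZ c g k : sq_integrable g -> fcoef (fun x => c * g x) k = c * fcoef g k.
Proof.
move=> Ig; rewrite /fcoef; under eq_fun do rewrite -mulrA.
by rewrite cintegralZ//; exact: cintegrable_fcoef.
Qed.

Lemma fcoefB g h k : sq_integrable g -> sq_integrable h ->
  fcoef (fun x => g x - h x) k = fcoef g k - fcoef h k.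
Proof.
move=> Ig Ih; rewrite /fcoef; under eq_fun do rewrite mulrBl.
by rewrite cintegralB//; exact: cintegrable_fcoef.
Qed.

Lemma rV_neq0 k : k != 0 -> exists j, k ord0 j != 0.
Proof.
move=> k0; apply/existsP; apply: contraNT k0 => /existsPn kn.
by apply/eqP/rowP => j; rewrite mxE; apply/eqP; rewrite -[_ == _]negbK kn.
Qed.

(** Some k_j is nonzero; up to sign and the factor 2 pi k_j, cosine and sine are then j-th partial
    derivatives of one another, hence derivatives of periodic functions. *)
Lemma integral_cos_sin_phase k : k != 0 ->
  \int[mu]_x cos (phase k x) = 0 /\ \int[mu]_x sin (phase k x) = 0.
Proof.
move=> /rV_neq0[j kj].
have c0 : 2 * pi * (k ord0 j)%:~R != 0 :> R.
  by rewrite mulf_neq0 ?intr_eq0// mulf_neq0// gt_eqF// pi_gt0.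
have [pc _] := test_cos_phase (R := R) k; have [ps _] := test_sin_phase (R := R) k.
have Ic : integ (fun x => cos (phase k x)) := (sq_integrable_cintegrable (sq_integrable_echar k)).1.
have Is : integ (fun x => sin (phase k x)) := (sq_integrable_cintegrable (sq_integrable_echar k)).2.
split.
- have := @integral_partial_periodic R d j (sin \o phase k) (@continuous_sin_phase R d k) ps
    (@derivable_sin_phase R d k j).
  have -> : partial j (sin \o phase k) = fun x : vec => 2 * pi * (k ord0 j)%:~R * cos (phase k x).
    by apply/funext => x; rewrite partial_sin_phase.
  have cc : continuous (fun x : vec => 2 * pi * (k ord0 j)%:~R * cos (phase k x)).
    move=> x; apply: (@continuous_comp _ _ _ (cos \o phase k) ( *%R (2 * pi * (k ord0 j)%:~R))).
      exact: continuous_cos_phase.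
    exact: mulrl_continuous.
  move=> /(_ cc) E0; apply: (mulfI c0); rewrite mulr0 -RintegralZl//.
  by rewrite /Rintegral E0.
- have := @integral_partial_periodic R d j (cos \o phase k) (@continuous_cos_phase R d k) pc
    (@derivable_cos_phase R d k j).
  have -> : partial j (cos \o phase k) = fun x : vec => - (2 * pi * (k ord0 j)%:~R) * sin (phase k x).
    by apply/funext => x; rewrite partial_cos_phase.
  have cc : continuous (fun x : vec => - (2 * pi * (k ord0 j)%:~R) * sin (phase k x)).
    move=> x; apply: (@continuous_comp _ _ _ (sin \o phase k) ( *%R (- (2 * pi * (k ord0 j)%:~R)))).
      exact: continuous_sin_phase.
    exact: mulrl_continuous.
  rewrite -oppr_eq0 in c0.
  move=> /(_ cc) E0; apply: (mulfI c0); rewrite mulr0 -RintegralZl//.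
  by rewrite /Rintegral E0.
Qed.

Lemma fcoef_echar k l : fcoef (@echar R d k) l = (k == l)%:R.
Proof.
rewrite /fcoef; under eq_fun do rewrite echar_conj -echarD.
have [->|kl] := eqVneq k l.
  apply: complex_eqP => /=.
    under eq_Rintegral do rewrite [X in cos X]phaseB subrr cos0.
    by rewrite Rintegral_cst// mul1r; exact: (congr1 fine (probability_setT mu)).
  under eq_Rintegral do rewrite [X in sin X]phaseB subrr sin0.
  by rewrite Rintegral_cst// mul0r.
have kl0 : k - l != 0 by rewrite subr_eq0.
by have [c0 s0] := integral_cos_sin_phase kl0; apply: complex_eqP.
Qed.

Lemma fcoef_tpoly s b l : uniq s -> fcoef (tpoly s b) l = if l \in s then b l else 0.
Proof.
move=> us; rewrite /fcoef /tpoly; under eq_fun do rewrite mulr_suml.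
rewrite (cintegral_sum (F := fun k x => b k * echar k x * (echar l x)^*)); last first.
  by move=> k _; apply: cintegrable_fcoef; apply/sq_integrableZ/sq_integrable_echar.
transitivity (\sum_(k <- s) b k * (k == l)%:R).
  by apply: eq_bigr => k _; rewrite -fcoef_echar -fcoefZ//; exact: sq_integrable_echar.
case: ifPn => ls.
  rewrite (bigD1_seq l)//= eqxx mulr1 big1 ?addr0// => k kl.
  by rewrite (negbTE kl) mulr0.
rewrite big1_seq// => k /andP[_ ks].
by rewrite (_ : k == l = false) ?mulr0//; apply: contraNF ls => /eqP <-.
Qed.

(** Parseval's identity with a polynomial on one side: the sum is finite and linearity suffices. *)
Lemma cintegral_tpoly_conj s b h : sq_integrable h ->
  cintegral (fun x => tpoly s b x * (h x)^*) = \sum_(k <- s) b k * (fcoef h k)^*.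
Proof.
move=> Ih; rewrite /tpoly; under eq_fun do rewrite mulr_suml.
have Iek k : cintegrable (fun x => echar k x * (h x)^*).
  by apply: sq_integrable_cintegrableM => //; exact: sq_integrable_echar.
rewrite (cintegral_sum (F := fun k x => b k * echar k x * (h x)^*)); last first.
  by move=> k _; under eq_fun do rewrite -mulrA; exact: cintegrableZ.
apply: eq_bigr => k _; under eq_fun do rewrite -mulrA.
rewrite cintegralZ//; congr (_ * _).
rewrite /fcoef -cintegral_conj; last exact: cintegrable_fcoef.
by congr cintegral; apply/funext => x; rewrite rmorphM /= conjCK mulrC.
Qed.

(** A complex coefficient mixes the two parts of g. Adding and subtracting those at k and -k
    isolates the four real integrals that [trig_null] is about. *)
Lemma fcoef_eq0_ae g : sq_integrable g -> (forall k, fcoef g k = 0) ->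
  {ae mu, forall x, g x = 0}.
Proof.
move=> Ig g0; have [Ir Ii] := sq_integrable_cintegrable Ig.
have E k : \int[mu]_x (Re (g x) * cos (phase k x)) + \int[mu]_x (Im (g x) * sin (phase k x)) = 0 /\
    \int[mu]_x (Im (g x) * cos (phase k x)) - \int[mu]_x (Re (g x) * sin (phase k x)) = 0.
  have r0 := congr1 (fun z => Re z) (g0 k); have i0 := congr1 (fun z => Im z) (g0 k).
  rewrite /= in r0 i0; split.
    rewrite -[RHS]r0 -RintegralD//; [|exact: integrable_mul_cos|exact: integrable_mul_sin].
    by apply: eq_Rintegral => x _; rewrite ReM Re_conj Im_conj Re_echar Im_echar mulrN opprK.
  rewrite -[RHS]i0 -RintegralB//; [|exact: integrable_mul_cos|exact: integrable_mul_sin].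
  by apply: eq_Rintegral => x _; rewrite ImM Re_conj Im_conj Re_echar Im_echar mulrN addrC.
have EN k : \int[mu]_x (Re (g x) * cos (phase k x)) - \int[mu]_x (Im (g x) * sin (phase k x)) = 0 /\
    \int[mu]_x (Im (g x) * cos (phase k x)) + \int[mu]_x (Re (g x) * sin (phase k x)) = 0.
  have [] := E (- k).
  under eq_Rintegral do rewrite phaseN cosN.
  under [X in _ + X]eq_Rintegral do rewrite phaseN sinN mulrN -mulN1r.
  under [X in _ -> X - _ = _ -> _]eq_Rintegral do rewrite phaseN cosN.
  under [X in _ -> _ - X = _ -> _]eq_Rintegral do rewrite phaseN sinN mulrN -mulN1r.
  rewrite !RintegralZl//; try exact: integrable_mul_sin.
  by rewrite !mulN1r opprK.
have Tr : trig_null (fun x => Re (g x)).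
  by split => // k; have [? ?] := E k; have [? ?] := EN k; split; lra.
have Ti : trig_null (fun x => Im (g x)).
  by split => // k; have [? ?] := E k; have [? ?] := EN k; split; lra.
by apply: filterS2 (trig_null_ae0 Tr) (trig_null_ae0 Ti) => x ? ?; exact: complex_eqP.
Qed.

Lemma finite_fsupp_tpoly g s : sq_integrable g -> uniq s -> (forall k, fcoef g k != 0 -> k \in s) ->
  {ae mu, forall x, g x = tpoly s (fcoef g) x}.
Proof.
move=> Ig us gs; have It := sq_integrable_tpoly s (fcoef g).
have D0 : forall k, fcoef (fun x => g x - tpoly s (fcoef g) x) k = 0.
  move=> k; rewrite fcoefB// fcoef_tpoly//; case: ifPn => [_|ks]; first by rewrite subrr.
  by rewrite subr0; apply/eqP; apply: contraNT ks; exact: gs.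
apply: filterS (fcoef_eq0_ae (sq_integrableB Ig It) D0) => x /eqP.
by rewrite subr_eq0 => /eqP.
Qed.

Lemma bessel g s : sq_integrable g -> uniq s ->
  \sum_(k <- s) sqn (fcoef g k) <= \int[mu]_x sqn (g x).
Proof.
move=> Ig us; set p := tpoly s (fcoef g); have Ip : sq_integrable p := sq_integrable_tpoly _ _.
(* Stated for any h that shares the coefficients of g on s: h = g gives the cross term of |g - p|^2,
   h = p its last term. *)
have pq (h : vec -> R[i]) : sq_integrable h -> (forall k, k \in s -> fcoef h k = fcoef g k) ->
    \int[mu]_x Re (p x * (h x)^*) = \sum_(k <- s) sqn (fcoef g k).
  move=> Ih hg; have := congr1 (fun z => Re z) (cintegral_tpoly_conj s (fcoef g) Ih).
  rewrite /= -/p => ->; rewrite Re_sum big_seq [RHS]big_seq.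
  by apply: eq_bigr => k ks; rewrite hg// mul_conj_sqn.
have Igp := sq_integrable_cintegrableM Ip Ig; have Ipp := sq_integrable_cintegrableM Ip Ip.
have E : \int[mu]_x sqn (g x - p x) =
    \int[mu]_x sqn (g x) - \sum_(k <- s) sqn (fcoef g k).
  transitivity (\int[mu]_x (sqn (g x) + (-2 * Re (p x * (g x)^*) + Re (p x * (p x)^*)))).
    apply: eq_Rintegral => x _.
    by rewrite /sqn !ReM !Re_conj !Im_conj ReD ImD ReN ImN; ring.
  have I1 := integrableZ_real (-2) Igp.1.
  rewrite (RintegralD measurableT Ig.2 (integrableD_real I1 Ipp.1)).
  rewrite (RintegralD measurableT I1 Ipp.1) (RintegralZl _ measurableT Igp.1).
  rewrite !pq//; first by ring.
  by move=> k ks; rewrite /p fcoef_tpoly// ks.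
rewrite -subr_ge0 -E; apply: Rintegral_ge0 => x _; exact: sqn_ge0.
Qed.

End square_integrable.

(** * Weak derivatives *)

Section weak_derivatives.
Context {R : realType} {d : nat}.
Local Notation vec := 'rV[R]_d.
Local Notation mu := (torus_measure R d).
Local Notation integ f := (mu.-integrable setT (EFin \o f)).
Local Notation Re := complex.Re.
Local Notation Im := complex.Im.
Local Notation e_ j := (delta_mx ord0 j).
Implicit Types (g h : vec -> R[i]) (k l : 'rV[int]_d) (f phi : vec -> R).

Lemma Re_cintegral g : Re (cintegral g) = \int[mu]_x Re (g x).
Proof. by []. Qed.

Lemma Im_cintegral g : Im (cintegral g) = \int[mu]_x Im (g x).
Proof. by []. Qed.

Lemma eLpnorm2E g : cmeasurable g ->
  (eLpnorm 2%:E g `^ 2 = \int[mu]_x (sqn (g x))%:E)%E.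
Proof.
move=> mg; rewrite /eLpnorm poweR_Lnorm//; apply: eq_integral => x _.
rewrite /= ger0_norm ?modulus_ge0// powR_mulrn ?modulus_ge0//.
by rewrite sqr_modulus.
Qed.

Lemma inLp2P g : inLp 2%:E g <-> Defs.periodic g /\ sq_integrable g.
Proof.
have E (mg : cmeasurable g) : (eLpnorm 2%:E g < +oo)%E <-> integ (fun x => sqn (g x)).
  have N : (\int[mu]_x `|(EFin \o (fun x => sqn (g x))) x| = \int[mu]_x (sqn (g x))%:E)%E.
    by apply: eq_integral => x _; rewrite /= ger0_norm ?sqn_ge0.
  (* Finiteness is tested on the square, which is an integral by [eLpnorm2E]. *)
  have -> : (eLpnorm 2%:E g < +oo)%E = (eLpnorm 2%:E g `^ 2 < +oo)%E.
    have := @Lnorm_ge0 _ _ _ mu 2%:E (fun x => (modulus (g x))%:E).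
    rewrite -/(eLpnorm 2%:E g); case: (eLpnorm 2%:E g) => [r| |]//= _.
      by rewrite !ltry.
    by rewrite (_ : (2 == 0 :> R) = false)//; apply/eqP; lra.
  rewrite eLpnorm2E// -N; split => [oo|/integrableP[]//].
  by apply/integrableP; split; [apply/measurable_EFinP; exact: measurable_sqn|exact: oo].
split => [[pg mg /E]|[pg [mg Ig]]]; first by move=> /(_ mg) Ig.
by split => //; exact/E.
Qed.

Lemma sqr_Lpnorm2 g : sq_integrable g -> Lpnorm 2%:E g ^+ 2 = \int[mu]_x sqn (g x).
Proof.
move=> [mg Ig]; have := eLpnorm2E mg; rewrite /Lpnorm.
have := @Lnorm_ge0 _ _ _ mu 2%:E (fun x => (modulus (g x))%:E).
rewrite -/(eLpnorm 2%:E g); case: (eLpnorm 2%:E g) => [r| |]//= r0.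
  rewrite powR_mulrn; last by rewrite -lee_fin.
  by move=> /(congr1 fine).
rewrite (_ : (2 == 0 :> R) = false); last by apply/eqP; lra.
by have := integrable_fin_num measurableT Ig => /[swap] <-.
Qed.

Lemma Lpnorm_ge0 p g : 0 <= Lpnorm p g.
Proof. by apply: fine_ge0; exact: Lnorm_ge0. Qed.

Lemma continuous_ae_bounded f : continuous f -> exists M, {ae mu, forall x, `|f x| <= M}.
Proof.
move=> cf; have [M fM] := continuous_bounded_cube cf; exists M.
by apply: filterS (@ae_unit_cube R d) => x; exact: fM.
Qed.

Lemma sqn_real (r : R) : sqn r%:C%C = r ^+ 2.
Proof. by rewrite /sqn /= expr0n addr0. Qed.

Lemma conj_real (r : R) : (r%:C%C)^* = r%:C%C.
Proof. by apply: complex_eqP; rewrite ?Re_conj ?Im_conj /= ?oppr0. Qed.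

Lemma sq_integrable_continuous f : continuous f -> sq_integrable (to_complex f).
Proof.
move=> cf; have [M fM] := continuous_ae_bounded cf.
have mf := cmeasurable_real (continuous_measurable_rV cf).
split => //; apply: (@ae_bounded_integrable _ _ _ _ _ (M ^+ 2)); first exact: measurable_sqn.
apply: filterS fM => x fx; rewrite ger0_norm ?sqn_ge0// sqn_real -real_normK ?num_real//.
by rewrite lerXn2r// nnegrE// (le_trans _ fx).
Qed.

Lemma cintegrable_mul_continuous g f : sq_integrable g -> continuous f ->
  cintegrable (fun x => g x * (f x)%:C%C).
Proof.
move=> Ig cf; have := sq_integrable_cintegrableM Ig (sq_integrable_continuous cf).
by under eq_fun do rewrite conj_real.
Qed.

Lemma integration_by_parts_periodic j f1 f2 :
  continuous f1 -> Defs.periodic f1 -> (forall x, derivable f1 x (e_ j)) -> continuous (partial j f1) ->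
  continuous f2 -> Defs.periodic f2 -> (forall x, derivable f2 x (e_ j)) -> continuous (partial j f2) ->
  \int[mu]_x (f1 x * partial j f2 x) = - \int[mu]_x (partial j f1 x * f2 x).
Proof.
move=> c1 p1 d1 cd1 c2 p2 d2 cd2.
have cM (u v : vec -> R) : continuous u -> continuous v -> continuous (fun x => u x * v x).
  by move=> cu cv x; apply: continuousM; [exact: cu|exact: cv].
have iM (u v : vec -> R) : continuous u -> continuous v -> integ (fun x => u x * v x).
  move=> cu cv; have [M uvM] := continuous_ae_bounded (cM _ _ cu cv).
  by apply: ae_bounded_integrable uvM; have := continuous_measurable_rV (cM _ _ cu cv).
have E x : partial j (f1 * f2) x = f1 x * partial j f2 x + partial j f1 x * f2 x.
  by rewrite /partial deriveM//= [X in _ + X]mulrC.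
have := @integral_partial_periodic R d j (f1 * f2).
move=> /(_ (cM _ _ c1 c2)) /(_ _) /(_ _) /(_ _) H.
apply/eqP; rewrite -addr_eq0 -RintegralD//; [|exact: iM|exact: iM].
rewrite /Rintegral; under eq_integral do rewrite -E.
rewrite H; first by [].
- by move=> x z /=; rewrite /GRing.mul /= p1 p2.
- by move=> x; exact: derivableM.
- rewrite (_ : partial j (f1 * f2) = (fun x => f1 x * partial j f2 x) \+ (fun x => partial j f1 x * f2 x)).
    by move=> x; apply: continuousD; exact: cM.
  by apply/funext => x; rewrite E.
Qed.

(** The number 2 pi i k_j, the Fourier multiplier of the j-th derivative. *)
Definition dcoef j k : R[i] := (0 +i* (2 * pi * (k ord0 j)%:~R))%C.

Lemma test_continuous phi : test_function phi -> continuous phi.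
Proof. by move=> [_ /(_ 0%N)[]]. Qed.

Lemma test_continuous_partial phi j : test_function phi -> continuous (partial j phi).
Proof. by move=> [_ /(_ 1%N)[_ /(_ j)[_ []]]]. Qed.

Lemma test_derivable phi j : test_function phi -> forall x, derivable phi x (e_ j).
Proof. by move=> [_ /(_ 1%N)[_ /(_ j)[]]]. Qed.

Lemma weak_partial_echar j k : is_weak_partial j (@echar R d k) (fun x => dcoef j k * echar k x).
Proof.
split.
  apply/inLp2P; split; first by move=> x z; rewrite echar_periodic.
  exact/sq_integrableZ/sq_integrable_echar.
move=> phi tphi; have tc := @test_cos_phase R d k; have ts := @test_sin_phase R d k.
have c0 := test_continuous tphi; have c1 := @test_continuous_partial _ j tphi.
have d1 := @test_derivable _ j tphi.
apply: complex_eqP; rewrite ?ReN ?ImN ?Re_cintegral ?Im_cintegral.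
- under eq_Rintegral do rewrite ReM Re_echar /= mulr0 subr0.
  rewrite (integration_by_parts_periodic (test_continuous tc) tc.1 (@test_derivable _ j tc)
    (@test_continuous_partial _ j tc) c0 tphi.1 d1 c1).
  congr (- _); apply: eq_Rintegral => x _.
  by rewrite partial_cos_phase ReM ReM Re_echar Im_echar /=; ring.
- under eq_Rintegral do rewrite ImM Im_echar /= mulr0 add0r.
  rewrite (integration_by_parts_periodic (test_continuous ts) ts.1 (@test_derivable _ j ts)
    (@test_continuous_partial _ j ts) c0 tphi.1 d1 c1).
  congr (- _); apply: eq_Rintegral => x _.
  by rewrite partial_sin_phase ImM ImM ReM Re_echar Im_echar /=; ring.
Qed.

Lemma weak_partial_sq_integrable j g h : is_weak_partial j g h -> sq_integrable h.
Proof. by move=> [/inLp2P[]]. Qed.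

Lemma weak_partial_tpoly j s (b : 'rV[int]_d -> R[i]) :
  is_weak_partial j (tpoly s b) (tpoly s (fun k => dcoef j k * b k)).
Proof.
split; first by apply/inLp2P; split; [exact: tpoly_periodic|exact: sq_integrable_tpoly].
move=> phi tphi; have c0 := test_continuous tphi; have c1 := @test_continuous_partial _ j tphi.
rewrite /tpoly; under eq_fun do rewrite mulr_suml; under [in RHS]eq_fun do rewrite mulr_suml.
rewrite (cintegral_sum (F := fun k x => b k * echar k x * (partial j phi x)%:C%C)); last first.
  move=> k _; apply: cintegrable_mul_continuous => //.
  exact/sq_integrableZ/sq_integrable_echar.
rewrite (cintegral_sum (F := fun k x => dcoef j k * b k * echar k x * (phi x)%:C%C)); last first.
  move=> k _; apply: cintegrable_mul_continuous => //.
  exact/sq_integrableZ/sq_integrable_echar.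
rewrite -sumrN; apply: eq_bigr => k _.
have [/inLp2P[_ Ih] /(_ _ tphi) E] := weak_partial_echar j k.
have Ie := sq_integrable_echar (R := R) k.
transitivity (b k * cintegral (fun x => echar k x * (partial j phi x)%:C%C)).
  rewrite -cintegralZ; last exact: cintegrable_mul_continuous.
  by congr cintegral; apply/funext => x; rewrite mulrA.
rewrite E mulrN -cintegralZ; last exact: cintegrable_mul_continuous.
by congr (- cintegral _); apply/funext => x; ring.
Qed.

Lemma weak_partialB j g1 g2 h1 h2 : sq_integrable g1 -> sq_integrable g2 ->
  is_weak_partial j g1 h1 -> is_weak_partial j g2 h2 ->
  is_weak_partial j (fun x => g1 x - g2 x) (fun x => h1 x - h2 x).
Proof.
move=> I1 I2 [/inLp2P[p1 J1] E1] [/inLp2P[p2 J2] E2]; split.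
  by apply/inLp2P; split; [move=> x z; rewrite p1 p2|exact: sq_integrableB].
move=> phi tphi; have c0 := test_continuous tphi; have c1 := @test_continuous_partial _ j tphi.
under eq_fun do rewrite mulrBl; under [in RHS]eq_fun do rewrite mulrBl.
rewrite !cintegralB ?E1 ?E2//; try exact: cintegrable_mul_continuous.
by rewrite opprB opprK addrC.
Qed.

(** Test functions are real, so a coefficient is split into its cosine integral minus i times its
    sine integral ([ec]). Testing with the cosine and the sine exchanges the two, with factors 2 pi
    k_j and -2 pi k_j. *)
Lemma weak_partial_fcoef j g h k : sq_integrable g -> is_weak_partial j g h ->
  fcoef h k = dcoef j k * fcoef g k.
Proof.
move=> Ig [/inLp2P[_ Ih] E].
have [Ec Es] := (E _ (test_cos_phase k), E _ (test_sin_phase k)).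
have ec (q : vec -> R[i]) : sq_integrable q -> fcoef q k =
    cintegral (fun x => q x * (cos (phase k x))%:C%C) - 'i%C * cintegral (fun x => q x * (sin (phase k x))%:C%C).
  move=> Iq; have Jc := cintegrable_mul_continuous Iq (@continuous_cos_phase R d k).
  have Js := cintegrable_mul_continuous Iq (@continuous_sin_phase R d k).
  rewrite -cintegralZ// -cintegralB//; last exact: cintegrableZ.
  congr cintegral; apply/funext => x; rewrite mulrCA -mulrBr; congr (_ * _).
  apply: complex_eqP; rewrite ?Re_conj ?Im_conj ?ReD ?ImD ?ReN ?ImN ?ReM ?ImM ?Re_echar ?Im_echar /=; ring.
have Jc := cintegrable_mul_continuous Ig (@continuous_cos_phase R d k).
have Js := cintegrable_mul_continuous Ig (@continuous_sin_phase R d k).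
set c : R := 2 * pi * (k ord0 j)%:~R.
have Hc : cintegral (fun x => h x * (cos (phase k x))%:C%C) =
    c%:C%C * cintegral (fun x => g x * (sin (phase k x))%:C%C).
  apply: oppr_inj; rewrite -[LHS]Ec -mulNr -rmorphN -cintegralZ//.
  by congr cintegral; apply/funext => x; rewrite partial_cos_phase rmorphM mulrCA.
have Hs : cintegral (fun x => h x * (sin (phase k x))%:C%C) =
    - (c%:C%C * cintegral (fun x => g x * (cos (phase k x))%:C%C)).
  apply: oppr_inj; rewrite -[LHS]Es opprK -cintegralZ//.
  by congr cintegral; apply/funext => x; rewrite partial_sin_phase rmorphM mulrCA.
rewrite !ec// Hc Hs.
have -> : dcoef j k = 'i%C * c%:C%C.
  by apply: complex_eqP; rewrite ?ReM ?ImM /= /c; ring.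
rewrite mulrBr mulrCA !mulrA -expr2 sqr_i; ring.
Qed.

(** Both derivatives have the coefficients prescribed by [weak_partial_fcoef], so their difference
    has none. *)
Lemma weak_partial_unique j g h1 h2 : sq_integrable g ->
  is_weak_partial j g h1 -> is_weak_partial j g h2 -> {ae mu, forall x, h1 x = h2 x}.
Proof.
move=> Ig W1 W2; have I1 := weak_partial_sq_integrable W1; have I2 := weak_partial_sq_integrable W2.
have E k : fcoef (fun x => h1 x - h2 x) k = 0.
  by rewrite fcoefB// (weak_partial_fcoef k Ig W1) (weak_partial_fcoef k Ig W2) subrr.
by apply: filterS (fcoef_eq0_ae (sq_integrableB I1 I2) E) => x /eqP; rewrite subr_eq0 => /eqP.
Qed.

Lemma wpartialP g : inH1 g -> forall j, is_weak_partial j g (wpartial j g).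
Proof. by move=> [_ Wg] j; have [h gh] := Wg j; exact: (@xgetI _ _ _ h). Qed.

End weak_derivatives.

(** * Energy of the residuals *)

Section energy.
Context {R : realType} {d : nat}.
Local Notation vec := 'rV[R]_d.
Local Notation mu := (torus_measure R d).
Local Notation integ f := (mu.-integrable setT (EFin \o f)).
Local Notation Re := complex.Re.
Local Notation Im := complex.Im.
Implicit Types (g h : vec -> R[i]) (k l : 'rV[int]_d) (S : seq 'rV[int]_d).

Lemma mul_conj_eq0 (z w : R[i]) : w = 0 -> z * w^* = 0.
Proof. by move=> ->; rewrite rmorph0 mulr0. Qed.

(* [0 <= A / 2 * (r - s p / A) ^ 2], for the real and the imaginary parts *)
Lemma Re_mul_conj_weighted (z w : R[i]) (A delta s : R) : 0 < A -> `|s| <= delta ->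
  Re (z * w^*) * s <= delta ^+ 2 / (2 * A) * sqn z + A / 2 * sqn w.
Proof.
move=> A0 sd.
have amgm (p r : R) : p * r * s <= delta ^+ 2 / (2 * A) * p ^+ 2 + A / 2 * r ^+ 2.
  have h1 : 0 <= A / 2 * (r - s * p / A) ^+ 2 by rewrite mulr_ge0 ?sqr_ge0// divr_ge0// ltW.
  have h1E : A / 2 * (r - s * p / A) ^+ 2 = A / 2 * r ^+ 2 - p * r * s + s ^+ 2 / (2 * A) * p ^+ 2.
    by field; rewrite gt_eqF.
  have h2 : s ^+ 2 / (2 * A) * p ^+ 2 <= delta ^+ 2 / (2 * A) * p ^+ 2.
    have s2 : s ^+ 2 <= delta ^+ 2.
      by rewrite -real_normK ?num_real// lerXn2r// nnegrE// (le_trans _ sd).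
    by apply: ler_wpM2r; [exact: sqr_ge0|apply: ler_wpM2r => //; rewrite invr_ge0; lra].
  by move: h1; rewrite h1E => h1; lra.
rewrite ReM Re_conj Im_conj mulrN opprK /sqn.
by have := amgm (Re z) (Re w); have := amgm (Im z) (Im w); lra.
Qed.

Lemma ae_le_Rintegral (f1 f2 : vec -> R) : integ f1 -> integ f2 ->
  {ae mu, forall x, f1 x <= f2 x} -> \int[mu]_x f1 x <= \int[mu]_x f2 x.
Proof.
move=> I1 I2 f12; have I := integrableD_real I2 (integrableN_real I1).
(* The absolute value changes the difference on a null set only, and makes it nonnegative
   everywhere. *)
have -> : \int[mu]_x f2 x = \int[mu]_x f1 x + \int[mu]_x `|f2 x - f1 x|.
  rewrite -RintegralD//; last exact: integrable_norm_real.
  apply: eq_ae_Rintegral; first exact: integrable_measurable_real I2.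
    by apply: integrable_measurable_real; apply: integrableD_real; last exact: integrable_norm_real I.
  by apply: filterS f12 => x f12; rewrite ger0_norm ?subr_ge0// addrC subrK.
by rewrite lerDl; apply: Rintegral_ge0.
Qed.

Lemma integrable_sum_real (I : eqType) (s : seq I) (F : I -> vec -> R) :
  (forall i, i \in s -> integ (F i)) -> integ (fun x => \sum_(i <- s) F i x).
Proof.
elim: s => [|i s IH] IF.
  by under eq_fun do rewrite big_nil; exact: (finite_measure_integrable_cst mu 0 measurableT).
under eq_fun do rewrite big_cons.
apply: integrableD_real; first by apply: IF; rewrite mem_head.
by apply: IH => j js; apply: IF; rewrite inE js orbT.
Qed.

Lemma Rintegral_sum (I : eqType) (s : seq I) (F : I -> vec -> R) :
  (forall i, i \in s -> integ (F i)) ->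
  \int[mu]_x (\sum_(i <- s) F i x) = \sum_(i <- s) \int[mu]_x F i x.
Proof.
elim: s => [|i s IH] IF.
  by under eq_Rintegral do rewrite big_nil; rewrite big_nil /Rintegral integral0_eq.
under eq_Rintegral do rewrite big_cons; rewrite big_cons RintegralD ?IH//.
- by move=> j js; apply: IF; rewrite inE js orbT.
- by apply: IF; rewrite mem_head.
- by apply: integrable_sum_real => j js; apply: IF; rewrite inE js orbT.
Qed.

Lemma freq_restrictE (D : set 'rV[int]_d) g : finite_set D ->
  freq_restrict D g = tpoly (finmap.enum_fset (fset_set D)) (fcoef g).
Proof. by move=> fD; apply/funext => x; rewrite /freq_restrict fsbig_finite. Qed.

Definition residual (u : vec -> R[i]) S : vec -> R[i] := fun x => u x - tpoly S (fcoef u) x.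

(** An explicit representative of the j-th derivative of the residual; the one chosen by [wpartial]
    agrees with it only almost everywhere ([wpartial_residual]). *)
Definition grad_residual (u : vec -> R[i]) S j : vec -> R[i] :=
  fun x => wpartial j u x - tpoly S (fun k => dcoef j k * fcoef u k) x.

(** The squared H-norm of the residual ([Hnorm_residual]); for S = [::] it is that of u. *)
Definition energy (u : vec -> R[i]) S : R := \sum_(j < d) \int[mu]_x sqn (grad_residual u S j x).

Section weak.
Context (u : vec -> R[i]) (Hu : inH1 u).

Lemma inH1_sq_integrable : sq_integrable u.
Proof. by have [/inLp2P[]] := Hu. Qed.

Lemma sq_integrable_wpartial j : sq_integrable (wpartial j u).
Proof. exact: weak_partial_sq_integrable (wpartialP Hu j). Qed.

Lemma sq_integrable_residual S : sq_integrable (residual u S).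
Proof. by apply: sq_integrableB; [exact: inH1_sq_integrable|exact: sq_integrable_tpoly]. Qed.

Lemma weak_partial_residual S j : is_weak_partial j (residual u S) (grad_residual u S j).
Proof.
apply: weak_partialB; [exact: inH1_sq_integrable|exact: sq_integrable_tpoly|exact: wpartialP|].
exact: weak_partial_tpoly.
Qed.

Lemma sq_integrable_grad_residual S j : sq_integrable (grad_residual u S j).
Proof. exact: weak_partial_sq_integrable (weak_partial_residual S j). Qed.

Lemma inH1_residual S : inH1 (residual u S).
Proof.
split; last by move=> j; exists (grad_residual u S j); exact: weak_partial_residual.
apply/inLp2P; split; last exact: sq_integrable_residual.
by move=> x z; have [/inLp2P[pu _] _] := Hu; rewrite /residual pu tpoly_periodic.
Qed.

Lemma wpartial_residual S j : {ae mu, forall x, wpartial j (residual u S) x = grad_residual u S j x}.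
Proof.
apply: weak_partial_unique (sq_integrable_residual S) _ (weak_partial_residual S j).
exact: wpartialP (inH1_residual S) j.
Qed.

Lemma fcoef_residual S k : uniq S -> k \in S -> fcoef (residual u S) k = 0.
Proof.
move=> uS kS; rewrite fcoefB; [|exact: inH1_sq_integrable|exact: sq_integrable_tpoly].
by rewrite fcoef_tpoly// kS subrr.
Qed.

Lemma fcoef_grad_residual S j k : uniq S -> k \in S -> fcoef (grad_residual u S j) k = 0.
Proof.
move=> uS kS.
rewrite (weak_partial_fcoef k (sq_integrable_residual S) (weak_partial_residual S j)).
by rewrite fcoef_residual// mulr0.
Qed.

Lemma Hnorm_residual S : Hnorm (residual u S) = Num.sqrt (energy u S).
Proof.
rewrite /Hnorm /energy -Rintegral_sum; last first.
  by move=> j _; exact: (sq_integrable_grad_residual S j).2.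
congr Num.sqrt; apply: eq_ae_Rintegral.
- apply: measurable_sum => j; under eq_fun do rewrite sqr_modulus.
  have [] := weak_partial_sq_integrable (wpartialP (inH1_residual S) j).
  by move=> /measurable_sqn.
- apply: integrable_measurable_real; apply: integrable_sum_real => j _.
  exact: (sq_integrable_grad_residual S j).2.
- have : {ae mu, forall x, forall j, wpartial j (residual u S) x = grad_residual u S j x}.
    by apply: filter_forall => j; exact: wpartial_residual.
  by apply: filterS => x wx; apply: eq_bigr => j _; rewrite sqr_modulus wx.
Qed.

Lemma integral_conj_residual_eq0 f S s : sq_integrable (to_complex f) ->
  uniq S -> uniq s -> (forall k, fcoef (to_complex f) k != 0 -> k \in s) -> {subset s <= S} ->
  cintegral (fun x => (f x)%:C%C * (residual u S x)^*) = 0.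
Proof.
move=> If uS us fs sS; have Ir := sq_integrable_residual S.
transitivity (cintegral (fun x => tpoly s (fcoef (to_complex f)) x * (residual u S x)^*)).
  apply: eq_ae_cintegral.
  - exact: cintegrable_measurable (sq_integrable_cintegrableM If Ir).
  - exact: cintegrable_measurable (sq_integrable_cintegrableM (sq_integrable_tpoly _ _) Ir).
  - by apply: filterS (finite_fsupp_tpoly If us fs) => x <-.
rewrite cintegral_tpoly_conj// big1_seq// => k /andP[_ ks].
by apply: mul_conj_eq0; apply: fcoef_residual => //; exact: sS.
Qed.

(** This is where stamping enters: multiplication by [a] moves a frequency k of S' to some k + l
    with l in supp a, that is into S, where the gradient residual has no coefficient. The factor e_k
    is shifted onto the residual, which leaves [a] as the only polynomial in Parseval's identity. *)
Lemma integral_stamp_eq0 (a : vec -> R) S S' sa j (b : 'rV[int]_d -> R[i]) :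
  sq_integrable (to_complex a) -> uniq S -> uniq sa ->
  (forall k, fcoef (to_complex a) k != 0 -> k \in sa) ->
  (forall k l, k \in S' -> l \in sa -> k + l \in S) ->
  cintegral (fun x => (a x)%:C%C * (tpoly S' b x * (grad_residual u S j x)^*)) = 0.
Proof.
move=> Ia uS usa asa SaS; set H := grad_residual u S j.
have IH : sq_integrable H := sq_integrable_grad_residual S j.
have IHk k : sq_integrable (fun x => H x * (echar k x)^*).
  by under eq_fun do rewrite echar_conj mulrC; exact: sq_integrable_mul_echar.
have IaH k : cintegrable (fun x => (a x)%:C%C * (H x * (echar k x)^*)^*).
  exact: sq_integrable_cintegrableM.
have aH0 k : k \in S' -> cintegral (fun x => (a x)%:C%C * (H x * (echar k x)^*)^*) = 0.
  move=> kS'.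
  transitivity (cintegral (fun x => tpoly sa (fcoef (to_complex a)) x * (H x * (echar k x)^*)^*)).
    apply: eq_ae_cintegral.
    - exact: cintegrable_measurable (IaH k).
    - exact: cintegrable_measurable (sq_integrable_cintegrableM (sq_integrable_tpoly _ _) (IHk k)).
    - by apply: filterS (finite_fsupp_tpoly Ia usa asa) => x <-.
  rewrite cintegral_tpoly_conj// big1_seq// => l /andP[_ lsa].
  apply: mul_conj_eq0; transitivity (fcoef H (k + l)); last first.
    by apply: fcoef_grad_residual => //; exact: SaS.
  by congr cintegral; apply/funext => x; rewrite echarD rmorphM mulrA.
transitivity (cintegral (fun x => \sum_(k <- S') b k * ((a x)%:C%C * (H x * (echar k x)^*)^*))).
  congr cintegral; apply/funext => x; rewrite /tpoly mulr_suml mulr_sumr.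
  by apply: eq_bigr => k _; rewrite rmorphM /= conjCK; ring.
rewrite (cintegral_sum (F := fun k x => b k * ((a x)%:C%C * (H x * (echar k x)^*)^*))); last first.
  by move=> k _; exact: cintegrableZ.
by apply: big1_seq => k /andP[_ kS']; rewrite cintegralZ// aH0// mulr0.
Qed.

Lemma integral_tpoly_grad_residual S S' j b : uniq S -> {subset S' <= S} ->
  cintegral (fun x => tpoly S' b x * (grad_residual u S j x)^*) = 0.
Proof.
move=> uS S'S; rewrite cintegral_tpoly_conj; last exact: sq_integrable_grad_residual.
apply: big1_seq => k /andP[_ kS'].
by apply: mul_conj_eq0; apply: fcoef_grad_residual => //; exact: S'S.
Qed.

(** The contraction in squared form. With E and E' the energies on S and S', the weighted inequality
    [Re_mul_conj_weighted] gives abar E <= delta^2 / (2 abar) E' + (abar / 2) E; the weight is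
    chosen so that half of the left-hand side absorbs the last term. *)
Lemma energy_step (a f : vec -> R) (abar delta M : R) S S' sa sf :
  weak_solution a f u ->
  measurable_fun setT a -> {ae mu, forall x, `|a x| <= M} ->
  0 < abar -> {ae mu, forall x, `|a x - abar| <= delta} ->
  sq_integrable (to_complex f) ->
  uniq sa -> (forall k, fcoef (to_complex a) k != 0 -> k \in sa) ->
  uniq sf -> (forall k, fcoef (to_complex f) k != 0 -> k \in sf) ->
  uniq S -> {subset S' <= S} -> {subset sf <= S} ->
  (forall k l, k \in S' -> l \in sa -> k + l \in S) ->
  energy u S <= (delta / abar) ^+ 2 * energy u S'.
Proof.
move=> Hsol ma aM abar0 adelta If usa asa usf fsf uS S'S sfS SaS.
set H := grad_residual u S; set W := grad_residual u S'.
have IH j : sq_integrable (H j) := sq_integrable_grad_residual S j.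
have IW j : sq_integrable (W j) := sq_integrable_grad_residual S' j.
have Iw := sq_integrable_wpartial.
have Ia : sq_integrable (to_complex a).
  split; first exact: cmeasurable_real.
  under eq_fun do rewrite sqn_real.
  apply: (@ae_bounded_integrable _ _ _ _ _ (M ^+ 2)); first exact: measurable_funX.
  apply: filterS aM => x ax; rewrite normrX lerXn2r// nnegrE//.
  exact: le_trans ax.
have Iag g h : sq_integrable g -> sq_integrable h ->
    cintegrable (fun x => (a x)%:C%C * (g x * (h x)^*)).
  move=> Ig Ih; under eq_fun do rewrite mulrA.
  apply: sq_integrable_cintegrableM => //.
  apply: (@sq_integrable_mul_bounded _ _ g (to_complex a) (M ^+ 2)) => //.
  apply: filterS aM => x ax; rewrite sqn_real -real_normK ?num_real// lerXn2r// nnegrE//.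
  exact: le_trans ax.
(* [W] differs from the gradient of u by a polynomial on S', which [integral_stamp_eq0] discards;
   what remains is the equation tested with the residual on S, once [H] is exchanged for
   [wpartial]. *)
have aWH0 : \sum_(j < d) cintegral (fun x => (a x)%:C%C * (W j x * (H j x)^*)) = 0.
  transitivity (\sum_(j < d) cintegral (fun x => (a x)%:C%C * (wpartial j u x * (H j x)^*))).
    apply: eq_bigr => j _.
    rewrite -[RHS]subr0 -(integral_stamp_eq0 j (fun k => dcoef j k * fcoef u k) Ia uS usa asa SaS).
    rewrite -cintegralB; [|exact: Iag|apply: Iag => //; exact: sq_integrable_tpoly].
    by congr cintegral; apply/funext => x; rewrite /W /H /grad_residual; ring.
  transitivity (cintegral (fun x => (a x)%:C%C *
      \sum_(j < d) wpartial j u x * (wpartial j (residual u S) x)^*)); last first.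
    rewrite (Hsol _ (inH1_residual S)).
    exact: (integral_conj_residual_eq0 If uS usf fsf sfS).
  transitivity (cintegral (fun x => \sum_(j < d) (a x)%:C%C * (wpartial j u x * (H j x)^*))).
    rewrite (cintegral_sum (F := fun j x => (a x)%:C%C * (wpartial j u x * (H j x)^*)))//.
    by move=> j _; exact: Iag.
  apply: eq_ae_cintegral.
  - apply: cintegrable_measurable; apply: cintegrable_sum => j _; exact: Iag.
  - under eq_fun do rewrite mulr_sumr.
    apply: cintegrable_measurable; apply: cintegrable_sum => j _; apply: Iag => //.
    exact: weak_partial_sq_integrable (wpartialP (inH1_residual S) j).
  - have : {ae mu, forall x, forall j, wpartial j (residual u S) x = H j x}.
      by apply: filter_forall => j; exact: wpartial_residual.
    apply: filterS => x wx; rewrite mulr_sumr; apply: eq_bigr => j _.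
    by rewrite wx.
(* [W] is [H] plus the polynomial on S minus the one on S', and both are orthogonal to [H]. *)
have WHH j : cintegral (fun x => W j x * (H j x)^*) = cintegral (fun x => H j x * (H j x)^*).
  pose b := fun k => dcoef j k * fcoef u k.
  rewrite -[RHS]addr0 -(integral_tpoly_grad_residual j b uS (fun k => id)).
  rewrite -[RHS]subr0 -(integral_tpoly_grad_residual j b uS S'S).
  have It s := sq_integrable_tpoly s b.
  rewrite -cintegralD; [|exact: sq_integrable_cintegrableM..].
  rewrite -cintegralB; [|apply: cintegrableD|]; try exact: sq_integrable_cintegrableM.
  by congr cintegral; apply/funext => x; rewrite /W /H /grad_residual -/b; ring.
have IReWH j : integ (fun x => Re (W j x * (H j x)^*)) := (sq_integrable_cintegrableM (IW j) (IH j)).1.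
have mdiff : measurable_fun setT (fun x => abar - a x) by exact: measurable_funB.
have diffb : {ae mu, forall x, `|abar - a x| <= delta}.
  by apply: filterS adelta => x; rewrite distrC.
(* The vanishing real part of [aWH0] is subtracted, which turns the constant weight abar into abar -
   a. *)
have E1 : abar * energy u S = \sum_(j < d) \int[mu]_x (Re (W j x * (H j x)^*) * (abar - a x)).
  have E2 j : \int[mu]_x sqn (H j x) = \int[mu]_x Re (W j x * (H j x)^*).
    rewrite -[RHS]/(Re (cintegral (fun x => W j x * (H j x)^*))) WHH Re_cintegral.
    by apply: eq_Rintegral => x _; rewrite mul_conj_sqn.
  have := congr1 (fun z => Re z) aWH0; rewrite Re_sum /= => R0.
  rewrite -[LHS]subr0 -[X in _ - X]R0 /energy mulr_sumr -sumrB.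
  apply: eq_bigr => j _; rewrite -/H E2 -RintegralZl//.
  rewrite -RintegralB//; [|exact: integrableZ_real|exact: (Iag _ _ (IW j) (IH j)).1].
  by apply: eq_Rintegral => x _; rewrite [in X in _ - X]ReM /= mul0r subr0; ring.
have bound j : \int[mu]_x (Re (W j x * (H j x)^*) * (abar - a x)) <=
    delta ^+ 2 / (2 * abar) * \int[mu]_x sqn (W j x) + abar / 2 * \int[mu]_x sqn (H j x).
  have J1 := integrableZ_real (delta ^+ 2 / (2 * abar)) (IW j).2.
  have J2 := integrableZ_real (abar / 2) (IH j).2.
  rewrite -(RintegralZl _ measurableT (IW j).2) -(RintegralZl _ measurableT (IH j).2).
  rewrite -(RintegralD measurableT J1 J2).
  apply: ae_le_Rintegral; [exact: integrable_mul_bounded diffb|exact: integrableD_real|].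
  by apply: filterS diffb => x dx; exact: Re_mul_conj_weighted.
have : abar * energy u S <= delta ^+ 2 / (2 * abar) * energy u S' + abar / 2 * energy u S.
  by rewrite E1 /energy !mulr_sumr -big_split/=; apply: ler_sum => j _; exact: bound.
move=> Ele; rewrite -(@ler_pM2l _ (abar / 2)) ?divr_gt0//.
have -> : abar / 2 * ((delta / abar) ^+ 2 * energy u S') = delta ^+ 2 / (2 * abar) * energy u S'.
  by field; rewrite gt_eqF.
lra.
Qed.

(** Each product of a coefficient of f with one of u is split with weight amin, and half of the
    energy is absorbed as in [energy_step]. Bessel's inequality serves twice, for f and for every
    partial derivative of u. *)
Lemma energy_nil (a f : vec -> R) (amin M : R) sf :
  weak_solution a f u -> fcoef u 0 = 0 ->
  measurable_fun setT a -> {ae mu, forall x, `|a x| <= M} ->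
  0 < amin -> {ae mu, forall x, amin <= a x} ->
  sq_integrable (to_complex f) ->
  uniq sf -> (forall k, fcoef (to_complex f) k != 0 -> k \in sf) ->
  energy u [::] <= (Lpnorm 2%:E (to_complex f) / amin) ^+ 2.
Proof.
move=> Hsol u0 ma aM amin0 aamin If usf fsf.
have Iu := inH1_sq_integrable.
have Iw j : integ (fun x => sqn (wpartial j u x)) := (sq_integrable_wpartial j).2.
have E0 : energy u [::] = \sum_(j < d) \int[mu]_x sqn (wpartial j u x).
  apply: eq_bigr => j _; apply: eq_Rintegral => x _.
  by rewrite /grad_residual /tpoly big_nil subr0.
have ISw : integ (fun x => \sum_(j < d) sqn (wpartial j u x)) by exact: integrable_sum_real.
have upper : \int[mu]_x ((\sum_(j < d) sqn (wpartial j u x)) * a x) =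
    \sum_(k <- sf) Re (fcoef (to_complex f) k * (fcoef u k)^*).
  rewrite -Re_sum -cintegral_tpoly_conj//.
  transitivity (Re (cintegral (fun x => (f x)%:C%C * (u x)^*))).
    rewrite -(Hsol _ Hu) Re_cintegral; apply: eq_Rintegral => x _.
    rewrite ReM /= mul0r subr0 mulrC Re_sum; congr (_ * _); apply: eq_bigr => j _.
    by rewrite mul_conj_sqn.
  congr (Re _); apply: eq_ae_cintegral.
  - exact: cintegrable_measurable (sq_integrable_cintegrableM If Iu).
  - exact: cintegrable_measurable (sq_integrable_cintegrableM (sq_integrable_tpoly _ _) Iu).
  - by apply: filterS (finite_fsupp_tpoly If usf fsf) => x <-.
have lower : amin * energy u [::] <= \int[mu]_x ((\sum_(j < d) sqn (wpartial j u x)) * a x).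
  rewrite E0 -Rintegral_sum// -RintegralZl//; apply: ae_le_Rintegral.
  - exact: integrableZ_real.
  - exact: integrable_mul_bounded aM.
  - apply: filterS aamin => x ax; rewrite mulrC ler_wpM2l// sumr_ge0// => j _.
    exact: sqn_ge0.
(* Poincare's inequality at a single frequency: if k_j != 0 then (2 pi k_j)^2 >= 1, so |u_k|^2 is at
   most the squared coefficient of the j-th derivative. Frequency 0 is covered by [u0]. *)
have term k : Re (fcoef (to_complex f) k * (fcoef u k)^*) <=
    (2 * amin)^-1 * sqn (fcoef (to_complex f) k) +
    amin / 2 * \sum_(j < d) sqn (fcoef (wpartial j u) k).
  have := Re_mul_conj_weighted (fcoef (to_complex f) k) (fcoef u k) amin0 (lexx `|1|).
  rewrite mulr1 normr1 expr1n div1r => /le_trans; apply; rewrite lerD2l ler_wpM2l//.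
    by rewrite divr_ge0// ltW.
  have [->|k0] := eqVneq k 0.
    rewrite u0 {1}/sqn /= expr0n addr0 sumr_ge0// => j _; exact: sqn_ge0.
  have [j kj] := rV_neq0 k0.
  rewrite (bigD1 j)//= -[leLHS]addr0 lerD//; last by rewrite sumr_ge0// => i _; exact: sqn_ge0.
  rewrite (weak_partial_fcoef k Iu (wpartialP Hu j)) sqnM ler_peMl ?sqn_ge0//.
  rewrite /sqn /= expr0n add0r exprMn.
  have kj1 : 1 <= ((k ord0 j)%:~R : R) ^+ 2.
    by rewrite -rmorphXn/= -[leLHS]/(1%:~R) ler_int -gtz0_ge1 exprn_even_gt0.
  have pi1 : 1 <= (2 * pi : R) ^+ 2.
    by rewrite exprn_ege1//; have := @pi_ge2 R; lra.
  by rewrite -[leLHS]mulr1 ler_pM.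
have F2 : \sum_(k <- sf) sqn (fcoef (to_complex f) k) <= Lpnorm 2%:E (to_complex f) ^+ 2.
  by rewrite sqr_Lpnorm2//; exact: bessel.
have W2 : \sum_(k <- sf) \sum_(j < d) sqn (fcoef (wpartial j u) k) <= energy u [::].
  rewrite exchange_big/= E0; apply: ler_sum => j _.
  by apply: bessel => //; exact: sq_integrable_wpartial.
have main : amin * energy u [::] <=
    (2 * amin)^-1 * Lpnorm 2%:E (to_complex f) ^+ 2 + amin / 2 * energy u [::].
  apply: (le_trans lower); rewrite upper; apply: (le_trans (ler_sum _ (fun k _ => term k))).
  rewrite big_split/= -!mulr_sumr lerD// ler_wpM2l//.
    by rewrite invr_ge0 mulr_ge0// ltW.
  by rewrite divr_ge0// ltW.
rewrite -(@ler_pM2l _ (amin / 2)) ?divr_gt0//.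
have -> : amin / 2 * (Lpnorm 2%:E (to_complex f) / amin) ^+ 2 =
    (2 * amin)^-1 * Lpnorm 2%:E (to_complex f) ^+ 2.
  by field; rewrite gt_eqF.
lra.
Qed.

End weak.
End energy.

(** * Essential suprema *)

Section essentially_bounded.
Context {R : realType} {d : nat}.
Local Notation vec := 'rV[R]_d.
Local Notation mu := (torus_measure R d).
Implicit Types g : vec -> R[i].

Lemma eLpnorm_pinftyE g : eLpnorm +oo%E g = ess_sup mu (fun x => (modulus (g x))%:E).
Proof.
(* The norm is an essential supremum provided the total mass is positive; here it is 1. *)
rewrite /eLpnorm unlock /= [X in (0 < X)%E](probability_setT mu) lte01.
congr ess_sup; apply/funext => x /=.
by rewrite ger0_norm ?modulus_ge0.
Qed.

Lemma ae_le_Lpnorm_pinfty g : (eLpnorm +oo%E g < +oo)%E ->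
  {ae mu, forall x, modulus (g x) <= Lpnorm +oo%E g}.
Proof.
move=> gfin; have g0 : (0 <= eLpnorm +oo%E g)%E by exact: Lnorm_ge0.
apply: filterS (ess_sup_ge mu (fun x => (modulus (g x))%:E)) => x.
rewrite -eLpnorm_pinftyE /Lpnorm -(@fineK _ (eLpnorm +oo%E g)) ?lee_fin//.
by rewrite ge0_fin_numE.
Qed.

Lemma eLpnorm_pinfty_lty g (M : R) : {ae mu, forall x, modulus (g x) <= M} ->
  (eLpnorm +oo%E g < +oo)%E.
Proof.
move=> gM; rewrite eLpnorm_pinftyE; apply: (@le_lt_trans _ _ M%:E); last exact: ltry.
by apply/ess_supP; apply: filterS gM => x; rewrite lee_fin.
Qed.

Lemma modulus_real (r : R) : modulus (r%:C%C) = `|r|.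
Proof. by rewrite /modulus /= expr0n addr0 sqrtr_sqr. Qed.

Lemma fcoef_real0 (a : vec -> R) : fcoef (to_complex a) 0 = (\int[mu]_x a x)%:C%C.
Proof.
have E x : to_complex a x * (echar 0 x)^* = (a x)%:C%C.
  by rewrite echar0 rmorph1 mulr1.
rewrite /fcoef; under eq_fun do rewrite E.
by apply: complex_eqP => //=; rewrite /Rintegral integral0_eq.
Qed.

End essentially_bounded.

(** * The error bound on the stamping sets *)

Lemma finite_stamp (R : realType) d (g : 'rV[R]_d -> R[i]) F N :
  finite_set F -> finite_set (fsupp g) -> finite_set (stamp g F N).
Proof. by move=> fF fg; elim: N => [//|N IH] /=; exact: finite_image2. Qed.

Lemma mem_enum_fset_set (T : choiceType) (A : set T) x : finite_set A ->
  (x \in finmap.enum_fset (fset_set A)) = (x \in A).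
Proof. by move=> fA; have := in_fset_set fA x. Qed.

Local Open Scope complex_scope.

Theorem lemma3 (R : realType) (d : nat) (a f : 'rV[R]_d -> R) (amin : R)
    (u : 'rV[R]_d -> R[i])
    (ha : inLp +oo%E (to_complex a))
    (hamin : 0 < amin)
    (hage : {ae torus_measure R d, forall x, amin <= a x})
    (hf : inLp 2%:E (to_complex f))
    (hf0 : fcoef (to_complex f) 0 = 0)
    (hu : inH u)
    (hsol : weak_solution a f u)
    (hsa : finite_set (fsupp (to_complex a)))
    (hsf : finite_set (fsupp (to_complex f))) :
  let delta :=
    Lpnorm +oo%E (fun x => (a x)%:C - fcoef (to_complex a) 0) in
  3 * delta < amin ->
  forall N : nat,
    Hnorm (fun x => u x - freq_restrict
      (stamp (to_complex a) (fsupp (to_complex f)) N) u x) <=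
    (delta / (amin - 2 * delta)) ^+ N.+1 * (Lpnorm 2%:E (to_complex f) / amin).
Proof.
(* The inclusions demanded by [energy_step] are vacuous for the empty list, the stage before supp
   f. *)
have nil_sub (S : seq 'rV[int]_d) : {subset [::] <= S} by [].
have nil_stamp (T S : seq 'rV[int]_d) k l : k \in [::] -> l \in T -> k + l \in S by [].
move=> delta hdelta N; have [Hu u0] := hu.
have [_ [ma _] aoo] := ha; rewrite /= in ma.
have /inLp2P[_ If] := hf.
pose M := Lpnorm +oo%E (to_complex a).
have aM : {ae torus_measure R d, forall x, `|a x| <= M}.
  by apply: filterS (ae_le_Lpnorm_pinfty aoo) => x; rewrite modulus_real.
have Ia := ae_bounded_integrable ma aM.
pose abar : R := \int[torus_measure R d]_x a x.
have adelta : {ae torus_measure R d, forall x, `|a x - abar| <= delta}.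
  pose g x := (a x)%:C - fcoef (to_complex a) 0.
  have gE x : g x = (a x - abar)%:C by rewrite rmorphB /g fcoef_real0.
  (* [delta] bounds |a - abar| only once the norm is known to be finite, since [fine] sends +oo to
     0. *)
  have gfin : (eLpnorm +oo%E g < +oo)%E.
    apply: (@eLpnorm_pinfty_lty _ _ _ (M + `|abar|)).
    apply: filterS aM => x ax; rewrite gE modulus_real.
    by rewrite (le_trans (ler_normB _ _))// lerD2r.
  apply: filterS (ae_le_Lpnorm_pinfty gfin) => x.
  by rewrite -/delta gE modulus_real.
have aminabar : amin <= abar.
  have -> : amin = \int[torus_measure R d]_x (fun=> amin) x.
    rewrite Rintegral_cst// -[LHS]mulr1; congr (_ * _).
    exact/esym/(congr1 fine (probability_setT (torus_measure R d))).
  by apply: ae_le_Rintegral => //; exact: finite_measure_integrable_cst.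
have abar0 : 0 < abar by exact: lt_le_trans aminabar.
have delta0 : 0 <= delta := Lpnorm_ge0 _ _.
pose st n := finmap.enum_fset (fset_set (stamp (to_complex a) (fsupp (to_complex f)) n)).
have stE n k : (k \in st n) = (k \in stamp (to_complex a) (fsupp (to_complex f)) n).
  by rewrite mem_enum_fset_set//; exact: finite_stamp.
have ust n : uniq (st n) := finmap.fset_uniq _.
pose sa := finmap.enum_fset (fset_set (fsupp (to_complex a))).
have saP k : fcoef (to_complex a) k != 0 -> k \in sa.
  by move=> ak; rewrite (mem_enum_fset_set _ hsa) in_setE; exact: ak.
have sfP k : fcoef (to_complex f) k != 0 -> k \in st 0%N by move=> fk; rewrite stE in_setE.
(* With 0 in supp a, every stamping set contains the previous one, and so supp f. *)
have sa0 : fcoef (to_complex a) 0 != 0.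
  by rewrite fcoef_real0 -/abar; apply/eqP => /complexI/eqP; rewrite gt_eqF.
have st_sub n : {subset st n <= st n.+1}.
  move=> k; rewrite !stE !in_setE => kn; exists k => //; exists 0; first exact: sa0.
  by rewrite addr0.
have stS n k l : k \in st n -> l \in sa -> k + l \in st n.+1.
  rewrite !stE !in_setE => kn lsa; exists k => //; exists l => //.
  by rewrite (mem_enum_fset_set _ hsa) in_setE in lsa; exact: lsa.
have st0 n : {subset st 0%N <= st n}.
  by elim: n => [//|n IH] k /IH; exact: st_sub.
set F := Lpnorm 2%:E (to_complex f) / amin.
have En n : energy u (st n) <= ((delta / abar) ^+ n.+1 * F) ^+ 2.
  elim: n => [|n IH].
    (* The passage from the empty set to supp f already gains a factor delta / abar, whence the
       exponent n + 1. *)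
    apply: (le_trans (energy_step Hu hsol ma aM abar0 adelta If
      (finmap.fset_uniq _) saP (ust 0%N) sfP (ust 0%N) (nil_sub _) (st0 0%N) (nil_stamp _ _))).
    rewrite expr1 [leRHS]exprMn; apply: ler_wpM2l; first exact: sqr_ge0.
    exact: (energy_nil Hu hsol u0 ma aM hamin hage If (ust 0%N) sfP).
  apply: (le_trans (energy_step Hu (S' := st n) hsol ma aM abar0 adelta If
    (finmap.fset_uniq _) saP (ust 0%N) sfP (ust n.+1) (st_sub n) (st0 n.+1) (@stS n))).
  by rewrite [_ ^+ n.+2]exprS -mulrA [leRHS]exprMn ler_wpM2l ?sqr_ge0.
have F0 : 0 <= F by rewrite divr_ge0 ?Lpnorm_ge0// ltW.
have -> : (fun x => u x - freq_restrict
    (stamp (to_complex a) (fsupp (to_complex f)) N) u x) = residual u (st N).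
  by apply/funext => x; rewrite freq_restrictE//; exact: finite_stamp.
rewrite (Hnorm_residual Hu).
(* [hdelta] and [delta0] make amin - 2 delta positive, so the inverses can be compared. *)
have rho : 0 <= delta / abar <= delta / (amin - 2 * delta).
  rewrite divr_ge0 ?(ltW abar0)//= ler_wpM2l// lef_pV2 ?posrE//; lra.
have /andP[rho0 rho1] := rho.
apply: (@le_trans _ _ ((delta / abar) ^+ N.+1 * F)).
  rewrite -(@ger0_norm _ ((delta / abar) ^+ N.+1 * F)) -?sqrtr_sqr; last first.
    by rewrite mulr_ge0// exprn_ge0.
  exact: ler_wsqrtr.
by rewrite ler_wpM2r// lerXn2r// nnegrE// (le_trans rho0).
Qed.
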